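(* There exists a constant $C>0$ independent of $d$ and $\mathcal T$ such that the following holds. Let $d\ge2$, let $\Omega\subset\mathbb R^d$ be a bounded polytopal domain and $\mathcal T$ a regular, simplicial triangulation of $\Omega$. Given $f\in\mathcal F$, let $\{T_i\}_{i=1}^{s(f)}$ be the simplices adjacent to $f$ and let $a_i:=(\mathcal V\cap\overline{T_i})\setminus\overline f\in\mathbb R^d$, $i=1,\dots,s(f)$. Then there exist $A_{f,T_i}\in\mathbb R^{1\times d}$, $b_{f,T_i}\in\mathbb R$, $i=1,\dots,s(f)$, such that $$\Phi_f^{\mathrm{CR}_0}:=\sum_{i=1}^{s(f)}\Phi^\times_{1,\kappa}\odot P\Big(\Phi^{\mathrm{Id}}_{1,2}\odot\big((A_{f,T_i},b_{f,T_i},\mathrm{Id}_{\mathbb R})\big),\ \Phi^{\mathbb 1}_{T_i}\Big)$$ satisfies $\theta_f^{\mathrm{CR}_0}(x)=R(\Phi_f^{\mathrm{CR}_0})(x)$ for a.e. $x\in\Omega$, for any $\kappa\ge d-1$. In addition, for all $f\in\mathcal F$, $$L(\Phi_f^{\mathrm{CR}_0})=5,\qquad M(\Phi_f^{\mathrm{CR}_0})\le C d^2s(f)\le2Cd^2.$$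
   Context: **Neural networks (NNs).** A NN with input dimension $d$ and depth $L$ is a finite sequence $\Phi=((A_1,b_1,\varrho_1),\dots,(A_L,b_L,\varrho_L))$ where, with $N_0=d$ and $N_1,\dots,N_L\in\mathbb N$, $A_\ell\in\mathbb R^{N_\ell\times N_{\ell-1}}$, $b_\ell\in\mathbb R^{N_\ell}$, and $\varrho_\ell$ is a list of $N_\ell$ activation functions acting componentwise; $\varrho_L=\mathrm{Id}$. Its realization is $R(\Phi):\mathbb R^d\to\mathbb R^{N_L}$, $x\mapsto x_L$, with $x_0=x$, $x_\ell=\varrho_\ell(A_\ell x_{\ell-1}+b_\ell)$ for $1\le\ell<L$, $x_L=A_Lx_{L-1}+b_L$. Depth: $L(\Phi)=L$. Size: $M(\Phi)=\sum_\ell(\|A_\ell\|_0+\|b_\ell\|_0)$, where $\|\cdot\|_0$ counts nonzero entries. ReLU: $\rho(x)=\max\{0,x\}$. BiSU: $\sigma(x)=0$ if $x\le0$, $\sigma(x)=1$ if $x>0$. A ReLU NN has only activations $\rho$ in hidden layers. **Operations.** For NNs $\Phi^1,\Phi^2$ of equal depth $L$ and equal input dimension: the parallelization $P(\Phi^1,\Phi^2)$ has $A_1=\binom{A_1^{(1)}}{A_1^{(2)}}$, $A_\ell=\mathrm{diag}(A^{(1)}_\ell,A^{(2)}_\ell)$ for $\ell\ge2$ and stacked biases and activations, so $R(P(\Phi^1,\Phi^2))=(R(\Phi^1),R(\Phi^2))$. The sum $\Phi^1+\Phi^2$ (equal output dimensions) has the hidden layers of $P(\Phi^1,\Phi^2)$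 and last layer $A_L=(A_L^{(1)}\ A_L^{(2)})$, $b_L=b_L^{(1)}+b_L^{(2)}$, so $R(\Phi^1+\Phi^2)=R(\Phi^1)+R(\Phi^2)$. The sparse concatenation $\Phi^1\odot\Phi^2$ (output dimension of $\Phi^2$ = input dimension of $\Phi^1$) has depth $L(\Phi^1)+L(\Phi^2)$: hidden layers of $\Phi^2$, then a ReLU layer with weights $\binom{A}{-A}$, $\binom{b}{-b}$ where $(A,b)$ is the last layer of $\Phi^2$, then the layers of $\Phi^1$ with first weight matrix $A_1^{(1)}$ replaced by $(A_1^{(1)}\ {-A_1^{(1)}})$; $R(\Phi^1\odot\Phi^2)=R(\Phi^1)\circ R(\Phi^2)$. **Building blocks.** $\Phi^{\mathrm{Id}}_{\mu,L}$: a fixed ReLU NN of depth $L$ and size $\le2\mu L$ realizing $\mathrm{Id}_{\mathbb R^\mu}$. $\Phi^\times_{\mu,\kappa}$ ($\kappa>0$): the ReLU NN of depth $2$ and size $12\mu$ whose $k$-th output at $(x_1,\dots,x_\mu,y)$ is $\frac\kappa2[\rho(\frac{x_k}\kappa+y)+\rho(-\frac{x_k}\kappa-y)-\rho(\frac{x_k}\kappa-y)-\rho(-\frac{x_k}\kappa+y)]$ (it equals $x_ky$ if $|x_k|\le\kappa$, $y\in\{0,1\}$). $\Phi^{\mathbb 1}_T$ for a $d$-simplex $T=\bigcap_{i=1}^{d+1}\{A_ix+b_i>0\}$ ($A_ix+b_i$ the barycentric coordinates): the NN of depth $3$ with first layer $\sigma(A_ix+b_i)$, $i=1,\dots,d+1$,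 second layer $\sigma(\sum_iy_i-(d+1-\frac14))$ and third layer the identity; it realizes $\mathbb 1_T$ on $\mathbb R^d$. **Meshes.** $\mathrm{conv}(Y)=\{\sum_{y\in Y}\lambda_yy:\lambda_y>0,\sum\lambda_y=1\}$ is the open convex hull; a $k$-simplex is $\mathrm{conv}(\{a_0,\dots,a_k\})$ with affinely independent $a_i\in\mathbb R^d$, and $|T|$ is its $k$-dimensional measure. A regular, simplicial partition $\mathcal T$ of $\Omega$ is a finite set of pairwise disjoint $d$-simplices with $\overline\Omega=\bigcup_T\overline T$ such that for distinct $T,T'$ the set $\overline T\cap\overline{T'}$ is empty or the closure of a common subsimplex. $\mathcal V$, $\mathcal F$: sets of vertices and of $(d-1)$-dimensional faces. **Crouzeix–Raviart shape functions.** $\mathrm{CR}_0(\mathcal T,\Omega)=\{v\in L^1(\Omega):v|_T\in\mathbb P_1\ \forall T\in\mathcal T,\ \int_f[v]_f=0\ \forall f\in\mathcal F,f\subset\Omega\}$, $[v]_f$ the jump across $f$. Its shape functions, indexed by $f\in\mathcal F$: if $f\subset\partial\Omega$ then $s(f)=1$, $T_1$ is the element with $f\subset\overline{T_1}$, $n_f$ is the unit normal to $f$ pointing out of $T_1$, and $\theta_f^{\mathrm{CR}_0}(x)=d\big(\frac1d-(1-\frac{|f|(x-a_1)\cdot n_f}{d|T_1|})\big)\mathbb 1_{T_1}(x)$. If $f\subset\Omega$ then $s(f)=2$, $\overline f=\overline{T_1}\cap\overline{T_2}$, $n_f$ is the unit normal to $f$ pointing from $T_1$ towards $T_2$, and $$\theta_f^{\mathrm{CR}_0}(x)=\begin{cases}d\big(\frac1d-(1-\frac{|f|(x-a_1)\cdot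 n_f}{d|T_1|})\big)&x\in T_1,\\ d\big(\frac1d-(1+\frac{|f|(x-a_2)\cdot n_f}{d|T_2|})\big)&x\in T_2,\\0&x\notin\overline{T_1\cup T_2}.\end{cases}$$ Here $a_i$ is the only vertex of $T_i$ not belonging to $\overline f$. *)

(* Defs.v *)
From HB Require Import structures.
From mathcomp Require Import all_boot all_order all_algebra finmap.
From mathcomp Require Import all_classical all_reals all_analysis.
Set Implicit Arguments.
Unset Strict Implicit.
Unset Printing Implicit Defensive.
Import Order.TTheory GRing.Theory Num.Theory.
Import numFieldNormedType.Exports.
Local Open Scope classical_set_scope.
Local Open Scope ring_scope.

Record layer (R : realType) (d m : nat) :=
  Layer { weight : 'M[R]_(m, d); bias : 'cV[R]_m }.

(* [nn R h d m]: networks with [h] hidden layers (depth [h.+1]), input dimension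
   [d] and output dimension [m]. A hidden layer consists of its width, its affine
   map and one activation function per neuron; the last layer is an affine map
   without activation. *)
Fixpoint nn (R : realType) (h d m : nat) : Type :=
  match h with
  | 0 => layer R d m
  | h'.+1 => {k : nat & (layer R d k * ('I_k -> R -> R) * nn R h' k m)%type}
  end.

Definition nn_out (R : realType) (d m : nat) (A : 'M[R]_(m, d)) (b : 'cV[R]_m) :
  nn R 0 d m := Layer A b.

Definition nn_hid (R : realType) (h d k m : nat) (A : 'M[R]_(k, d))
    (b : 'cV[R]_k) (rho : 'I_k -> R -> R) (Phi : nn R h k m) : nn R h.+1 d m :=
  existT _ k (Layer A b, rho, Phi).

Definition affine (R : realType) (d m : nat) (l : layer R d m) (x : 'cV[R]_d) :
  'cV[R]_m := weight l *m x + bias l.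

Fixpoint realize (R : realType) (h d m : nat) :
    nn R h d m -> 'cV[R]_d -> 'cV[R]_m :=
  match h with
  | 0 => fun l x => affine l x
  | h'.+1 => fun Phi x =>
      let: existT k (l, rho, Psi) := Phi in
      realize Psi (\col_i rho i (affine l x i 0))
  end.

Fixpoint depth (R : realType) (h d m : nat) : nn R h d m -> nat :=
  match h with
  | 0 => fun _ => 1%N
  | h'.+1 => fun Phi => let: existT k (_, _, Psi) := Phi in (depth Psi).+1
  end.

Definition norm0 (R : realType) (m n : nat) (A : 'M[R]_(m, n)) : nat :=
  #|[set p : 'I_m * 'I_n | A p.1 p.2 != 0]%SET|.

Definition layer_size (R : realType) (d m : nat) (l : layer R d m) : nat :=
  (norm0 (weight l) + norm0 (bias l))%N.

Fixpoint nn_size (R : realType) (h d m : nat) : nn R h d m -> nat :=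
  match h with
  | 0 => fun l => layer_size l
  | h'.+1 => fun Phi =>
      let: existT k (l, _, Psi) := Phi in (layer_size l + nn_size Psi)%N
  end.

Definition relu (R : realType) (x : R) : R := Num.max 0 x.

Definition bisu (R : realType) (x : R) : R := if x <= 0 then 0 else 1.

Fixpoint is_relu_nn (R : realType) (h d m : nat) : nn R h d m -> Prop :=
  match h with
  | 0 => fun _ => True
  | h'.+1 => fun Phi =>
      let: existT k (_, rho, Psi) := Phi in
      (forall i, rho i = @relu R) /\ is_relu_nn Psi
  end.

Definition stack (R : realType) (k1 k2 : nat) (r1 : 'I_k1 -> R -> R)
    (r2 : 'I_k2 -> R -> R) (i : 'I_(k1 + k2)) : R -> R :=
  match fintype.split i with inl j => r1 j | inr j => r2 j end.

(* Juxtaposition of two networks acting on independent inputs; it provides the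
   block-diagonal layers [l >= 2] of a parallelization. *)
Fixpoint par_diag (R : realType) (h d1 d2 m1 m2 : nat) :
    nn R h d1 m1 -> nn R h d2 m2 -> nn R h (d1 + d2) (m1 + m2) :=
  match h with
  | 0 => fun l1 l2 =>
      Layer (block_mx (weight l1) 0 0 (weight l2)) (col_mx (bias l1) (bias l2))
  | h'.+1 => fun Phi1 Phi2 =>
      let: existT k1 (l1, r1, Psi1) := Phi1 in
      let: existT k2 (l2, r2, Psi2) := Phi2 in
      nn_hid (block_mx (weight l1) 0 0 (weight l2)) (col_mx (bias l1) (bias l2))
        (stack r1 r2) (par_diag Psi1 Psi2)
  end.

Definition nn_par (R : realType) (h d m1 m2 : nat) :
    nn R h d m1 -> nn R h d m2 -> nn R h d (m1 + m2) :=
  match h with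
  | 0 => fun l1 l2 =>
      Layer (col_mx (weight l1) (weight l2)) (col_mx (bias l1) (bias l2))
  | h'.+1 => fun Phi1 Phi2 =>
      let: existT k1 (l1, r1, Psi1) := Phi1 in
      let: existT k2 (l2, r2, Psi2) := Phi2 in
      nn_hid (col_mx (weight l1) (weight l2)) (col_mx (bias l1) (bias l2))
        (stack r1 r2) (par_diag Psi1 Psi2)
  end.

(* Same hidden layers as [par_diag]; the last layers are added. *)
Fixpoint add_diag (R : realType) (h d1 d2 m : nat) :
    nn R h d1 m -> nn R h d2 m -> nn R h (d1 + d2) m :=
  match h with
  | 0 => fun l1 l2 =>
      Layer (row_mx (weight l1) (weight l2)) (bias l1 + bias l2)
  | h'.+1 => fun Phi1 Phi2 =>
      let: existT k1 (l1, r1, Psi1) := Phi1 in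
      let: existT k2 (l2, r2, Psi2) := Phi2 in
      nn_hid (block_mx (weight l1) 0 0 (weight l2)) (col_mx (bias l1) (bias l2))
        (stack r1 r2) (add_diag Psi1 Psi2)
  end.

(* Networks of depth 1 have no hidden layer and share their input, so there the
   weight matrices are added. *)
Definition nn_add (R : realType) (h d m : nat) :
    nn R h d m -> nn R h d m -> nn R h d m :=
  match h with
  | 0 => fun l1 l2 => Layer (weight l1 + weight l2) (bias l1 + bias l2)
  | h'.+1 => fun Phi1 Phi2 =>
      let: existT k1 (l1, r1, Psi1) := Phi1 in
      let: existT k2 (l2, r2, Psi2) := Phi2 in
      nn_hid (col_mx (weight l1) (weight l2)) (col_mx (bias l1) (bias l2))
        (stack r1 r2) (add_diag Psi1 Psi2)
  end.

Fixpoint nn_zero (R : realType) (h d m : nat) : nn R h d m :=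
  match h with
  | 0 => Layer 0 0
  | h'.+1 => nn_hid (0 : 'M[R]_(0, d)) 0 (fun _ => idfun) (nn_zero R h' 0 m)
  end.

(* The sum of a nonempty list of networks; [nn_zero] only makes it total. *)
Definition nn_sum (R : realType) (h d m : nat) (s : seq (nn R h d m)) :
    nn R h d m :=
  if s is Phi :: s' then foldl (@nn_add R h d m) Phi s' else nn_zero R h d m.

Definition split_input (R : realType) (h k m : nat) :
    nn R h k m -> nn R h (k + k) m :=
  match h with
  | 0 => fun l => Layer (row_mx (weight l) (- weight l)) (bias l)
  | h'.+1 => fun Phi =>
      let: existT j (l, rho, Psi) := Phi in
      nn_hid (row_mx (weight l) (- weight l)) (bias l) rho Psi
  end.

(* Sparse concatenation: [nn_sconc Phi2 Phi1] is Phi1 (.) Phi2. *)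
Fixpoint nn_sconc (R : realType) (h2 h1 d k m : nat) :
    nn R h2 d k -> nn R h1 k m -> nn R (h2 + h1).+1 d m :=
  match h2 with
  | 0 => fun l Phi1 =>
      nn_hid (col_mx (weight l) (- weight l)) (col_mx (bias l) (- bias l))
        (fun _ => @relu R) (split_input Phi1)
  | h'.+1 => fun Phi2 Phi1 =>
      let: existT j (l, rho, Psi2) := Phi2 in
      nn_hid (weight l) (bias l) rho (nn_sconc Psi2 Phi1)
  end.

Notation "Phi1 '\odot' Phi2" := (nn_sconc Phi2 Phi1)
  (at level 40, left associativity) : ring_scope.

(* The properties characterizing the network Phi^Id_{mu, h+1}. *)
Definition is_identity_nn (R : realType) (mu h : nat) (Phi : nn R h mu mu) :
    Prop :=
  [/\ is_relu_nn Phi, depth Phi = h.+1,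
      (nn_size Phi <= 2 * mu * h.+1)%N & forall x, realize Phi x = x].

Definition times_nn (R : realType) (mu : nat) (kappa : R) :
    nn R 1 (mu + 1) mu :=
  let one : 'cV[R]_mu := const_mx 1 in
  nn_hid
    (col_mx (col_mx (row_mx (kappa^-1)%:M one) (row_mx (- kappa^-1)%:M (- one)))
            (col_mx (row_mx (kappa^-1)%:M (- one)) (row_mx (- kappa^-1)%:M one)))
    0 (fun _ => @relu R)
    (nn_out (row_mx (row_mx (kappa / 2)%:M (kappa / 2)%:M)
                    (row_mx (- (kappa / 2))%:M (- (kappa / 2))%:M)) 0).

(* For the vertices a_0, ..., a_d of a d-simplex, the matrix with columns
   (a_j ; 1). Its inverse (A b) satisfies A a_j + b = e_j, so the entries of
   A x + b are the barycentric coordinates of x. *)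
Definition vertex_mx (R : realType) (d : nat) (K : {fset 'cV[R]_d}) :
    'M[R]_(d + 1) :=
  col_mx (\matrix_(i < d, j < d + 1) (nth 0 (enum_fset K) j) i 0) (const_mx 1).

Definition bary_weight (R : realType) (d : nat) (K : {fset 'cV[R]_d}) :
  'M[R]_(d + 1, d) := lsubmx (invmx (vertex_mx K)).

Definition bary_bias (R : realType) (d : nat) (K : {fset 'cV[R]_d}) :
  'cV[R]_(d + 1) := rsubmx (invmx (vertex_mx K)).

Definition indicator_nn (R : realType) (d : nat) (K : {fset 'cV[R]_d}) :
    nn R 2 d 1 :=
  nn_hid (bary_weight K) (bary_bias K) (fun _ => @bisu R)
    (nn_hid (const_mx 1 : 'M[R]_(1, d + 1))
            (const_mx (- ((d + 1)%:R - 1 / 4))) (fun _ => @bisu R)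
      (nn_out 1%:M 0)).

Fixpoint lebesgue_tuple (R : realType) (n : nat) :
    set (n.-tuple (measurableTypeR R)) -> \bar R :=
  match n with
  | 0 => \d_([tuple])
  | n'.+1 => pushforward (@lebesgue_measure R \x @lebesgue_tuple R n')%E
               (fun p => [tuple of p.1 :: p.2])
  end.

Definition col_of_tuple (R : realType) (n : nat)
  (t : n.-tuple (measurableTypeR R)) : 'cV[R]_n := \col_i tnth t i.

Definition lebesgue_col (R : realType) (n : nat) (A : set 'cV[R]_n) : \bar R :=
  lebesgue_tuple (@col_of_tuple R n @^-1` A).

Definition ae_col (R : realType) (n : nat) (P : 'cV[R]_n -> Prop) : Prop :=
  {ae @lebesgue_tuple R n, forall t, P (col_of_tuple t)}.

(* The k-dimensional measure of a subset of a k-dimensional affine subspace of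
   R^d: its Lebesgue measure in orthonormal coordinates y |-> U y + p of the
   subspace. The value does not depend on the coordinates. *)
Definition kmeasure (R : realType) (d k : nat) (A : set 'cV[R]_d) : R :=
  fine (xget 0%E [set v | exists (U : 'M[R]_(d, k)) (p : 'cV[R]_d),
    [/\ U^T *m U = 1%:M, A `<=` range (fun y => U *m y + p) &
        v = lebesgue_col [set y | A (U *m y + p)]]]).

(* A simplex is represented by the finite set of its vertices. *)

Definition open_hull (R : realType) (d : nat) (Y : {fset 'cV[R]_d}) :
    set 'cV[R]_d :=
  [set x | exists l : 'cV[R]_d -> R,
     [/\ forall y, y \in Y -> 0 < l y, \sum_(y <- Y) l y = 1 &
         x = \sum_(y <- Y) l y *: y]].

Definition affinely_independent (R : realType) (d : nat) (Y : {fset 'cV[R]_d}) :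
    Prop :=
  forall l : 'cV[R]_d -> R,
    \sum_(y <- Y) l y = 0 -> \sum_(y <- Y) l y *: y = 0 ->
    forall y, y \in Y -> l y = 0.

Definition is_simplex (R : realType) (d k : nat) (Y : {fset 'cV[R]_d}) : Prop :=
  #|` Y| = k.+1 /\ affinely_independent Y.

Definition frontier (R : realType) (d : nat) (A : set 'cV[R]_d) :
    set 'cV[R]_d :=
  closure A `\` A^°.

(* Polytopal: the interior of a finite union of closed convex polytopes. *)
Definition bounded_polytopal_domain (R : realType) (d : nat)
    (Omega : set 'cV[R]_d) : Prop :=
  [/\ Omega !=set0, open Omega, connected Omega, bounded_set Omega &
      exists P : {fset {fset 'cV[R]_d}},
        Omega = (\bigcup_(Y in [set` P]) closure (open_hull Y))^°].

Definition regular_partition (R : realType) (d : nat) (Omega : set 'cV[R]_d)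
    (M : {fset {fset 'cV[R]_d}}) : Prop :=
  [/\ forall K, K \in M -> is_simplex d K,
      forall K K', K \in M -> K' \in M -> K <> K' ->
        open_hull K `&` open_hull K' = set0,
      closure Omega = \bigcup_(K in [set` M]) closure (open_hull K) &
      forall K K', K \in M -> K' \in M -> K <> K' ->
        closure (open_hull K) `&` closure (open_hull K') = set0 \/
        exists S : {fset 'cV[R]_d},
          [/\ S != fset0, (S `<=` K)%fset, (S `<=` K')%fset &
              closure (open_hull K) `&` closure (open_hull K')
              = closure (open_hull S)]].

Definition vertices (R : realType) (d : nat) (M : {fset {fset 'cV[R]_d}}) :
  set 'cV[R]_d := [set a | exists2 K, K \in M & a \in K].

Definition is_face (R : realType) (d : nat) (M : {fset {fset 'cV[R]_d}})
    (F : {fset 'cV[R]_d}) : Prop :=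
  exists K, [/\ K \in M, (F `<=` K)%fset & #|` F| = d].

Definition adjacent_elements (R : realType) (d : nat)
    (M : {fset {fset 'cV[R]_d}}) (F : {fset 'cV[R]_d}) : {fset {fset 'cV[R]_d}} :=
  [fset K in M | `[< (open_hull F `<=` closure (open_hull K))%classic >]]%fset.

Definition num_adjacent (R : realType) (d : nat) (M : {fset {fset 'cV[R]_d}})
  (F : {fset 'cV[R]_d}) : nat := #|` adjacent_elements M F|.

Definition dot (R : realType) (d : nat) (u v : 'cV[R]_d) : R := (u^T *m v) 0 0.

Definition unit_normal (R : realType) (d : nat) (F : {fset 'cV[R]_d})
    (n : 'cV[R]_d) : Prop :=
  dot n n = 1 /\
  forall x y, open_hull F x -> open_hull F y -> dot (x - y) n = 0.

Definition points_out_of (R : realType) (d : nat) (K F : {fset 'cV[R]_d})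
    (n : 'cV[R]_d) : Prop :=
  forall x y, open_hull K x -> open_hull F y -> dot (x - y) n < 0.

(* [theta] is a representative of the shape function of the face with vertex set
   [F], where [T i], [i < s], are the elements adjacent to the face and [a i] is
   the vertex of [T i] opposite to it. In the second case [theta] is arbitrary on
   the boundaries of the two elements, where the shape function is not
   specified. *)
Definition is_CR0_shape (R : realType) (d : nat) (Omega : set 'cV[R]_d)
    (F : {fset 'cV[R]_d}) (s : nat) (T : 'I_s -> {fset 'cV[R]_d})
    (a : 'I_s -> 'cV[R]_d) (theta : 'cV[R]_d -> R) : Prop :=
  let vol i := kmeasure d (open_hull (T i)) in
  let area := kmeasure d.-1 (open_hull F) in
  (exists i1 n,
    [/\ open_hull F `<=` frontier Omega, (forall i, i = i1),
        unit_normal F n, points_out_of (T i1) F n &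
        forall x, theta x =
          d%:R * (d%:R^-1 - (1 - area * dot (x - a i1) n / (d%:R * vol i1)))
          * \1_(open_hull (T i1)) x])
  \/
  (exists i1 i2 n,
    [/\ open_hull F `<=` Omega /\
        closure (open_hull F)
        = closure (open_hull (T i1)) `&` closure (open_hull (T i2)),
        unit_normal F n /\
        points_out_of (T i1) F n /\ points_out_of (T i2) F (- n),
        forall x, open_hull (T i1) x -> theta x =
          d%:R * (d%:R^-1 - (1 - area * dot (x - a i1) n / (d%:R * vol i1))),
        forall x, open_hull (T i2) x -> theta x =
          d%:R * (d%:R^-1 - (1 + area * dot (x - a i2) n / (d%:R * vol i2))) &
        forall x, ~ closure (open_hull (T i1) `|` open_hull (T i2)) x ->
          theta x = 0]).

Definition CR0_nn (R : realType) (d s : nat) (PhiId : nn R 1 1 1) (kappa : R)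
    (T : 'I_s -> {fset 'cV[R]_d}) (A : 'I_s -> 'M[R]_(1, d)) (b : 'I_s -> R) :
    nn R 4 d 1 :=
  nn_sum [seq times_nn 1 kappa \odot
                nn_par (PhiId \odot nn_out (A i) (const_mx (b i)))
                       (indicator_nn (T i)) | i <- enum 'I_s].

(* Main.v *)
Require Import Defs.
From HB Require Import structures.
From mathcomp Require Import all_boot all_order all_algebra finmap.
From mathcomp Require Import all_classical all_reals all_analysis.
From mathcomp Require Import measurable_realfun ring lra zify.
Import Order.TTheory GRing.Theory Num.Theory.
Import numFieldNormedType.Exports.
Set Implicit Arguments.
Unset Strict Implicit.
Unset Printing Implicit Defensive.
Local Open Scope classical_set_scope.
Local Open Scope ring_scope.

(** On a simplex [T] with face [F] and opposite vertex [a], the shape function of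
    [F] is [1 - d * lambda], where [lambda] is the barycentric coordinate at [a]:
    the signed distance to [a] along the unit normal, divided by the height, is
    [1 - lambda], and area / (d * volume) is the reciprocal of the height. Since
    barycentric coordinates are affine, [1 - d * lambda] is realized by one affine
    layer, whose parameters depend neither on the normal nor on [kappa]. On [T]
    its values lie between [1 - d] and [1], so for [kappa >= d - 1 >= 1] the
    product network multiplies it exactly by the indicator of [T], and the sum
    over the adjacent elements is the shape function off the element boundaries,
    which are null sets ([realize_branch], [ae_bcoord_neq0]).

    The relation volume = area * height / d carries the analytic content, because
    volumes and areas are Lebesgue measures in arbitrary orthonormal coordinates.
    It is proved by computing both. A simplex is the preimage of the standard
    simplex under its barycentric coordinates, so by the affine change of
    variables formula ([lebesgue_col_affine]) its measure is the inverse of a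
    determinant times 1 / d! ([lebesgue_corner]). In an orthonormal basis
    consisting of the normal and of coordinates of the face, the determinant of
    the simplex is block triangular and is the one of the face divided by the
    height ([kmeasure_face], [height_formula]). The change of variables formula
    is proved by induction on the dimension: every invertible matrix is a product
    of three block triangular ones, each of which acts on slices or on lines.

    The bound by [2 * C * d ^ 2] needs that a face has at most two adjacent
    elements ([num_adjacent_le2]): two elements on the same side of the hyperplane
    of the face would intersect. The size estimate itself only uses that all the
    network operations at most double the number of nonzero weights, the dominant
    part being the [d + 1] by [d] matrix of barycentric coordinates. *)

(** * Lebesgue measure on tuples is a sigma-finite measure *)

Section LebesgueTupleMeasure.
Variable R : realType.
Local Notation RR := (measurableTypeR R).

Definition cons_pair n (p : RR * n.-tuple RR) : n.+1.-tuple RR :=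
  [tuple of p.1 :: p.2].

Definition uncons n (t : n.+1.-tuple RR) : RR * n.-tuple RR :=
  (thead t, [tuple of behead t]).

Lemma cons_pairK n : cancel (@cons_pair n) (@uncons n).
Proof. by case=> x t; congr pair; apply: val_inj. Qed.

Lemma measurable_cons_pair n : measurable_fun setT (@cons_pair n).
Proof. exact: measurable_cons. Qed.

Lemma measurable_uncons n : measurable_fun setT (@uncons n).
Proof.
apply/measurable_fun_pairP; split.
- exact: (@measurable_tnth _ RR n.+1 ord0).
- exact: (@measurable_behead _ RR n).
Qed.

Lemma measurable_preim_cons n (A : set (n.+1.-tuple RR)) :
  measurable A -> measurable (@cons_pair n @^-1` A).
Proof.
by move=> mA; rewrite -[X in measurable X]setTI; exact: measurable_cons_pair.
Qed.

Lemma measurable_preim_uncons n (A : set (RR * n.-tuple RR)) :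
  measurable A -> measurable (@uncons n @^-1` A).
Proof.
by move=> mA; rewrite -[X in measurable X]setTI; exact: measurable_uncons.
Qed.

(** The map [uncons] is a measurable inverse of [cons_pair], so an exhaustion of
    the product by rectangles of finite measure transports to the tuples. *)
Section ConsMeasure.
Variables (n : nat) (mu : {sigma_finite_measure set (n.-tuple RR) -> \bar R}).
Let nu := pushforward (@lebesgue_measure R \x mu)%E (@cons_pair n).
Let mc := @measurable_cons_pair n.

Let nu0 : nu set0 = 0%E. Proof. exact: measure0. Qed.
Let nu_ge0 A : (0 <= nu A)%E. Proof. exact: measure_ge0. Qed.
Let nu_add : semi_sigma_additive nu.
Proof. exact: measure_semi_sigma_additive. Qed.

HB.instance Definition _ := isMeasure.Build _ _ _ nu nu0 nu_ge0 nu_add.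

Let nu_sigma_finite : sigma_finite setT nu.
Proof.
have /sigma_finiteP[F [TF ndF Foo]] := sigma_finiteT (@lebesgue_measure R).
have /sigma_finiteP[G [TG ndG Goo]] := sigma_finiteT mu.
exists (fun k => @uncons n @^-1` (F k `*` G k)).
  apply/esym; rewrite -subTset => t _.
  have [j _ Fj] : (\bigcup_k F k) (uncons t).1 by rewrite -TF.
  have [k _ Gk] : (\bigcup_k G k) (uncons t).2 by rewrite -TG.
  exists (maxn j k) => //; split.
  - by move: Fj; exact/subsetPset/ndF/leq_maxl.
  - by move: Gk; exact/subsetPset/ndG/leq_maxr.
move=> k; have [mF Fk] := Foo k; have [mG Gk] := Goo k.
split; first by apply: measurable_preim_uncons; exact: measurableX.
rewrite /nu /pushforward -comp_preimage (_ : _ \o _ = idfun); last first.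
  by apply/funext => p /=; rewrite cons_pairK.
by rewrite preimage_id product_measure1E// lte_mul_pinfty// ge0_fin_numE.
Qed.

HB.instance Definition _ :=
  Measure_isSigmaFinite.Build _ _ _ nu nu_sigma_finite.

Lemma sigma_finite_cons : exists m : {sigma_finite_measure set _ -> \bar R},
  pushforward (@lebesgue_measure R \x mu)%E (@cons_pair n) = m.
Proof. by exists nu. Qed.

End ConsMeasure.

Lemma lebesgue_tuple_sigma_finite n :
  exists mu : {sigma_finite_measure set (n.-tuple RR) -> \bar R},
    @lebesgue_tuple R n = mu.
Proof.
elim: n => [|n [mu IH]] /=.
  by exists (\d_([tuple] : 0.-tuple RR)).
by rewrite IH; exact: sigma_finite_cons.
Qed.

End LebesgueTupleMeasure.

Section LebesgueTupleInstance.
Variables (R : realType) (n : nat).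
Let mu := @lebesgue_tuple R n.

Let mu0 : mu set0 = 0%E.
Proof. by rewrite /mu; have [m ->] := lebesgue_tuple_sigma_finite R n. Qed.
Let mu_ge0 A : (0 <= mu A)%E.
Proof. by rewrite /mu; have [m ->] := lebesgue_tuple_sigma_finite R n. Qed.
Let mu_add : semi_sigma_additive mu.
Proof.
rewrite /mu; have [m ->] := lebesgue_tuple_sigma_finite R n.
exact: measure_semi_sigma_additive.
Qed.
HB.instance Definition _ :=
  isMeasure.Build _ _ _ (@lebesgue_tuple R n) mu0 mu_ge0 mu_add.
Let mu_sf : sigma_finite setT (@lebesgue_tuple R n).
Proof.
have [m ->] := lebesgue_tuple_sigma_finite R n; exact: sigma_finiteT.
Qed.
HB.instance Definition _ :=
  Measure_isSigmaFinite.Build _ _ _ (@lebesgue_tuple R n) mu_sf.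
End LebesgueTupleInstance.

(** * The affine change of variables formula *)

Section AffineLine.
Variable R : realType.
Local Notation RR := (measurableTypeR R).
Variables (a b : R).
Hypothesis a0 : a != 0.
Let f (x : RR) : RR := a * x + b.

Let mf : measurable_fun setT f.
Proof. by apply: measurable_funD => //; exact: measurable_funM. Qed.

Let nu := pushforward (@lebesgue_measure R) f.
Let nu0 : nu set0 = 0%E. Proof. exact: measure0. Qed.
Let nu_ge0 A : (0 <= nu A)%E. Proof. exact: measure_ge0. Qed.
Let nu_add : semi_sigma_additive nu.
Proof. exact: measure_semi_sigma_additive. Qed.
HB.instance Definition _ := isMeasure.Build _ _ _ nu nu0 nu_ge0 nu_add.

(** Both sides are measures in the set; by uniqueness of the Lebesgue measure it
    suffices to compare them on intervals. *)
Lemma lebesgue_measure_affine (A : set RR) : measurable A ->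
  (`|a|%:E * @lebesgue_measure R (f @^-1` A))%E = @lebesgue_measure R A.
Proof.
move=> mA; apply/esym.
apply: (lebesgue_measure_unique (mu := mscale (`|a|%:nng) nu)) => // X.
case=> -[x y] _ <- /=; rewrite /mscale /= /nu /pushforward.
have [apos|aneg|/eqP] := ltgtP 0 a; last by rewrite eq_sym (negbTE a0).
- have -> : f @^-1` `]x, y] = `](x - b) / a, (y - b) / a]%classic.
    apply/seteqP; split=> z /=; rewrite !in_itv /= /f ler_pdivlMr// ltr_pdivrMr//;
      by rewrite lerBrDr ltrBlDr mulrC.
  rewrite !lebesgue_measure_itv /= !lte_fin ltr_pM2r ?invr_gt0// ltrD2r.
  case: ifPn => _; last by rewrite mule0.
  rewrite gtr0_norm// -EFinD -EFinM; congr EFin; field.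
  exact: lt0r_neq0.
- have -> : f @^-1` `]x, y] = `[(y - b) / a, (x - b) / a[%classic.
    apply/seteqP; split=> z /=; rewrite !in_itv /= /f ler_ndivrMr// ltr_ndivlMr//;
      by rewrite lerBrDr ltrBlDr mulrC andbC.
  rewrite !lebesgue_measure_itv /= !lte_fin ltr_nM2r ?invr_lt0// ltrD2r.
  case: ifPn => _; last by rewrite mule0.
  rewrite ltr0_norm// -EFinD -EFinM; congr EFin; field.
  exact: ltr0_neq0.
Qed.

End AffineLine.

Section LebesgueCol.
Variable R : realType.
Local Notation RR := (measurableTypeR R).

Definition measurable_col n (A : set 'cV[R]_n) : Prop :=
  measurable (@col_of_tuple R n @^-1` A).

Definition vcons n (x : R) (y : 'cV[R]_n) : 'cV[R]_(1 + n) :=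
  col_mx (const_mx x) y.

Lemma col_of_cons n (x : RR) (t : n.-tuple RR) :
  col_of_tuple (cons_pair (x, t)) = vcons x (col_of_tuple t).
Proof.
apply/matrixP => i j; rewrite mxE /vcons.
case: (unliftP ord0 i) => [k ->|->].
  transitivity (col_mx (const_mx x : 'cV_1) (col_of_tuple t) (rshift 1 k) j).
    by rewrite col_mxEd mxE tnthS; congr tnth; apply: val_inj.
  by congr fun_of_matrix; apply: val_inj.
transitivity (col_mx (const_mx x : 'cV_1) (col_of_tuple t) (lshift n ord0) j).
  by rewrite col_mxEu mxE.
by congr fun_of_matrix; apply: val_inj.
Qed.

Definition tuple_of_col n (c : 'cV[R]_n) : n.-tuple RR := [tuple c i 0 | i < n].

Lemma tuple_of_colK n : cancel (@tuple_of_col n) (@col_of_tuple R n).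
Proof.
by move=> c; apply/matrixP => i j; rewrite mxE tnth_mktuple ord1.
Qed.

Lemma measurable_linear_form n (g : 'rV[R]_n) (c : R) :
  measurable_fun setT
    (fun t : n.-tuple RR => (g *m col_of_tuple t) 0 0 + c : RR).
Proof.
apply: measurable_funD => //.
under eq_fun do rewrite mxE.
apply: measurable_sum => j; apply: measurable_funM => //.
under eq_fun do rewrite mxE; exact: measurable_tnth.
Qed.

Lemma measurable_col_affine n m (M : 'M[R]_(m, n)) v (A : set 'cV[R]_m) :
  measurable_col A -> measurable_col [set y | A (M *m y + v)].
Proof.
move=> mA; rewrite /measurable_col.
pose h (t : n.-tuple RR) := tuple_of_col (M *m col_of_tuple t + v).
have mh : measurable_fun setT h.
  apply/measurable_fun_tnthP => i.
  rewrite [X in measurable_fun _ X](_ : _ = fun t : n.-tuple RR =>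
    (row i M *m col_of_tuple t) 0 0 + v i 0).
    exact: measurable_linear_form.
  apply/funext => t /=.
  by rewrite tnth_mktuple mxE -row_mul [row _ _ _ _]mxE.
rewrite (_ : _ @^-1` _ = setT `&` h @^-1` (@col_of_tuple R m @^-1` A)).
  exact: mh.
by rewrite setTI; apply/seteqP; split=> t /=; rewrite /h tuple_of_colK.
Qed.

(** The definition of the measure integrates over the first coordinate last;
    [lebesgue_col_line] is the opposite order of integration. *)
Lemma lebesgue_col_slice n (A : set 'cV[R]_(1 + n)) :
  lebesgue_col A =
  (\int[@lebesgue_measure R]_x lebesgue_col [set y | A (vcons x y)])%E.
Proof.
rewrite /lebesgue_col /= /pushforward /product_measure1.
apply: eq_integral => x _ /=; congr lebesgue_tuple; apply/seteqP.
by split => t /=; rewrite /xsection /= inE /= -col_of_cons.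
Qed.

Lemma measurable_preim_pair n (A : set 'cV[R]_(1 + n)) : measurable_col A ->
  measurable [set p : RR * n.-tuple RR | A (vcons p.1 (col_of_tuple p.2))].
Proof.
move=> mA; have := measurable_preim_cons (n := n) mA.
by congr measurable; apply/seteqP; split => -[x t] /=; rewrite col_of_cons.
Qed.

Lemma measurable_slice n (A : set 'cV[R]_(1 + n)) x : measurable_col A ->
  measurable_col [set y : 'cV[R]_n | A (vcons x y)].
Proof.
move=> /measurable_preim_pair /(measurable_xsection x).
congr measurable; apply/seteqP.
by split => t /=; rewrite /xsection /= inE.
Qed.

Lemma measurable_fun_slice n (A : set 'cV[R]_(1 + n)) : measurable_col A ->
  measurable_fun setT
    (fun x : RR => lebesgue_col [set y : 'cV[R]_n | A (vcons x y)]).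
Proof.
move=> /measurable_preim_pair /(measurable_fun_xsection (@lebesgue_tuple R n)).
congr measurable_fun; apply/funext => x /=; congr lebesgue_tuple; apply/seteqP.
by split => t /=; rewrite /xsection /= inE.
Qed.

Lemma measurable_line n (A : set 'cV[R]_(1 + n)) t : measurable_col A ->
  measurable [set x : RR | A (vcons x (col_of_tuple t))].
Proof.
move=> /measurable_preim_pair /(measurable_ysection t).
congr measurable; apply/seteqP.
by split => x /=; rewrite /ysection /= inE.
Qed.

Lemma measurable_fun_line n (A : set 'cV[R]_(1 + n)) : measurable_col A ->
  measurable_fun setT (fun t : n.-tuple RR =>
    @lebesgue_measure R [set x | A (vcons x (col_of_tuple t))]).
Proof.
move=> /measurable_preim_pair /(measurable_fun_ysection (@lebesgue_measure R)).
congr measurable_fun; apply/funext => x /=; congr lebesgue_measure; apply/seteqP.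
by split => t /=; rewrite /ysection /= inE.
Qed.

Lemma lebesgue_col_line n (A : set 'cV[R]_(1 + n)) : measurable_col A ->
  lebesgue_col A =
  (\int[@lebesgue_tuple R n]_t
     @lebesgue_measure R [set x | A (vcons x (col_of_tuple t))])%E.
Proof.
move=> /measurable_preim_pair mA.
have := indic_fubini_tonelli (@lebesgue_measure R) (@lebesgue_tuple R n) mA.
rewrite indic_fubini_tonelli_FE// indic_fubini_tonelli_GE// => E.
rewrite lebesgue_col_slice; transitivity
  (\int[@lebesgue_measure R]_x (@lebesgue_tuple R n \o xsection
   [set p : RR * n.-tuple RR | A (vcons p.1 (col_of_tuple p.2))]) x)%E.
  apply: eq_integral => x _ /=; congr lebesgue_tuple; apply/seteqP.
  by split => t /=; rewrite /xsection /= inE.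
rewrite E; apply: eq_integral => t _ /=; congr lebesgue_measure; apply/seteqP.
by split => x /=; rewrite /ysection /= inE.
Qed.

End LebesgueCol.

Section AffineChange.
Variable R : realType.

(** The change of variables formula for one affine map, with the determinant on
    the side of the preimage so that no division is needed. *)
Definition scales_lebesgue n (M : 'M[R]_n) (v : 'cV[R]_n) : Prop :=
  forall A : set 'cV[R]_n, measurable_col A ->
  (`|\det M|%:E * lebesgue_col [set y | A (M *m y + v)%R] = lebesgue_col A)%E.

Lemma scales_lebesgue_comp n (M N : 'M[R]_n) v w :
  scales_lebesgue M v -> scales_lebesgue N w ->
  scales_lebesgue (M *m N) (M *m w + v).
Proof.
move=> hM hN A mA; rewrite -(hM A)// -(hN [set y | A (M *m y + v)]); last first.
  exact: measurable_col_affine.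
rewrite det_mulmx normrM EFinM muleA; congr (_ * lebesgue_col _)%E.
by apply/seteqP; split => y /=; rewrite mulmxDr mulmxA addrA.
Qed.

(** Each slice at a fixed first coordinate is transformed by an affine map with
    linear part [D], whose offset depends on that coordinate; this is why the
    induction on the dimension has to carry arbitrary offsets. *)
Lemma scales_lebesgue_lower n (c : 'cV[R]_n) (D : 'M[R]_n) (w : 'cV[R]_n) :
  (forall v, scales_lebesgue D v) ->
  @scales_lebesgue (1 + n) (block_mx 1%:M 0 c D) (col_mx 0 w).
Proof.
move=> hD A mA; rewrite det_lblock det1 mul1r !lebesgue_col_slice.
set B := [set y | _].
have mB : measurable_col B by exact: measurable_col_affine.
rewrite -ge0_integralZl//; last exact: measurable_fun_slice.
apply: eq_integral => x _.
rewrite -(hD (c *m const_mx x + w) [set y | A (vcons x y)]); last first.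
  exact: measurable_slice.
congr (_ * lebesgue_col _)%E; apply/seteqP; rewrite /B /vcons.
by split => y /=; rewrite mul_block_col add_col_mx mul1mx mul0mx !addr0
  addrA (addrC (D *m y)).
Qed.

(** Here every line parallel to the first axis is mapped to itself by an affine
    map of slope [a], so Tonelli reduces the claim to dimension one. *)
Lemma scales_lebesgue_upper n (a : R) (r : 'rV[R]_n) (s : R) : a != 0 ->
  @scales_lebesgue (1 + n) (block_mx a%:M r 0 1%:M) (col_mx (const_mx s) 0).
Proof.
move=> a0 A mA; rewrite det_ublock det1 mulr1 det_scalar1.
rewrite lebesgue_col_line; last exact: measurable_col_affine.
set B := [set y | _].
have mB : measurable_col B by exact: measurable_col_affine.
rewrite lebesgue_col_line// -ge0_integralZl//; last exact: measurable_fun_line.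
apply: eq_integral => t _.
rewrite -(@lebesgue_measure_affine _ a ((r *m col_of_tuple t) 0 0 + s) a0
  [set x | A (vcons x (col_of_tuple t))]); last exact: measurable_line.
congr (_ * lebesgue_measure _)%E.
suff e x : (block_mx a%:M r 0 1%:M) *m vcons x (col_of_tuple t)
    + col_mx (const_mx s) 0
    = vcons (a * x + ((r *m col_of_tuple t) 0 0 + s)) (col_of_tuple t).
  by apply/seteqP; split => x; rewrite /B /= e.
rewrite /vcons mul_block_col add_col_mx mul0mx mul1mx add0r addr0.
congr col_mx; apply/matrixP => i j; rewrite !ord1 mul_scalar_mx addrA.
by rewrite [LHS]mxE [X in X + _ = _]mxE 2![in LHS]mxE !mxE.
Qed.

(** The witness is a transposed kernel vector [w] of [D]: if
    [z *m (D + c *m w) = 0], multiplying by [w^T] kills the first term and gives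
    [z *m c = 0], hence [z *m D = 0]. *)
Lemma rank1_shift_unit n (c : 'cV[R]_n) (D : 'M[R]_n) :
  (forall z : 'rV[R]_n, z *m c = 0 -> z *m D = 0 -> z = 0) ->
  exists w : 'rV[R]_n, D + c *m w \in unitmx.
Proof.
move=> hcD; have [uD|nuD] := boolP (D \in unitmx).
  by exists 0; rewrite mulmx0 addr0.
have [w w0 wD] : exists2 w : 'rV[R]_n, w != 0 & w *m D^T = 0.
  have : ~~ row_free D^T by rewrite row_free_unit unitmx_tr.
  rewrite -kermx_eq0 => /rowV0Pn[w wk w0]; exists w => //.
  exact/sub_kermxP.
exists w; rewrite -row_free_unit; apply: inj_row_free => z.
have Dw : D *m w^T = 0 by rewrite -[D]trmxK -trmx_mul wD trmx0.
move=> hz; have wwT : w *m w^T != 0.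
  apply: contra w0 => /eqP/matrixP/(_ 0 0); rewrite !mxE => /eqP.
  rewrite psumr_eq0 => [/allP h|i _]; last by rewrite mxE -expr2 sqr_ge0.
  apply/eqP/matrixP => i j; rewrite ord1 mxE; apply/eqP.
  by have := h j; rewrite mem_index_enum mxE mulf_eq0 orbb => /(_ isT).
have zc : z *m c = 0.
  have : z *m (D + c *m w) *m w^T = 0 by rewrite hz mul0mx.
  rewrite -mulmxA mulmxDl Dw add0r -mulmxA mulmxA.
  rewrite [z *m c]mx11_scalar mul_scalar_mx => /eqP.
  by rewrite scaler_eq0 (negbTE wwT) orbF => /eqP ->; rewrite raddf0.
apply: hcD => //.
by move: hz; rewrite mulmxDr mulmxA zc mul0mx addr0.
Qed.

(** An invertible matrix with blocks a, r, c, D is a product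
    upper * lower * upper of the block triangular matrices treated above as soon
    as its lower right block is invertible, and multiplying by an upper shear
    makes that block invertible by [rank1_shift_unit]. *)
Lemma lebesgue_col_affine n (M : 'M[R]_n) (v : 'cV[R]_n) :
  M \in unitmx -> scales_lebesgue M v.
Proof.
elim: n M v => [|n IH] M v uM.
  move=> A mA; rewrite det_mx00 normr1 mul1e; congr lebesgue_col.
  by apply/seteqP; split=> y /=; rewrite (flatmx0 (_ + _)) (flatmx0 y).
pose a := @ulsubmx R 1 n 1 n M; pose r := @ursubmx R 1 n 1 n M.
pose c := @dlsubmx R 1 n 1 n M; pose D := @drsubmx R 1 n 1 n M.
have EM : M = block_mx a r c D :> 'M[R]_(1 + n) by rewrite submxK.
have [w uDw] : exists w : 'rV[R]_n, D + c *m w \in unitmx.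
  apply: rank1_shift_unit => z zc zD.
  have : row_mx 0 z *m (M : 'M[R]_(1 + n)) = 0.
    by rewrite EM mul_row_block !mul0mx !add0r zc zD row_mx0.
  move/(congr1 (fun B => B *m invmx M)); rewrite mul0mx -mulmxA mulmxV// mulmx1.
  by move/(congr1 (@rsubmx R 1 1 n)); rewrite row_mxKr => ->; rewrite linear0.
set D' := D + c *m w in uDw.
pose r' := (r + a *m w) *m invmx D'.
pose a' := a - r' *m c.
(* Here a' is the Schur complement of D' after shearing the columns by w. *)
pose U1 : 'M[R]_(1 + n) := block_mx (a' 0 0)%:M r' 0 1%:M.
pose L : 'M[R]_(1 + n) := block_mx 1%:M 0 c D'.
pose U2 : 'M[R]_(1 + n) := block_mx 1%:M (- w) 0 1%:M.
have EM2 : M = U1 *m L *m U2.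
  rewrite EM /U1 /L /U2 -mx11_scalar !mulmx_block.
  rewrite !(mulmx0, mul0mx, mulmx1, mul1mx, addr0, add0r).
  have e1 : r' *m D' = r + a *m w by rewrite -mulmxA mulVmx// mulmx1.
  rewrite e1 subrK.
  have -> : a *m - w + (r + a *m w) = r by rewrite mulmxN addrC addrK.
  by have -> : c *m - w + D' = D by rewrite mulmxN addrC addrK.
have a'0 : a' 0 0 != 0.
  have dU1 : \det U1 = a' 0 0 by rewrite /U1 det_ublock det_scalar1 det1 mulr1.
  apply: contraL uM => /eqP z; rewrite unitmxE EM2 !det_mulmx dU1 z !mul0r.
  by rewrite unitr0.
pose v0 := @usubmx R 1 n 1 v; pose v1 := @dsubmx R 1 n 1 v.
(* The offset of the outermost factor absorbs what U1 does to v1. *)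
have -> : v = (U1 *m L) *m 0 + (U1 *m col_mx 0 v1
    + col_mx (const_mx ((v0 - r' *m v1) 0 0)) 0).
  rewrite mulmx0 add0r /U1 mul_block_col !(mulmx0, mul0mx, mul1mx, addr0, add0r).
  rewrite add_col_mx addr0.
  rewrite [const_mx _](_ : _ = v0 - r' *m v1); last first.
    by apply/matrixP => i j; rewrite !ord1 mxE.
  by rewrite addrC subrK vsubmxK.
rewrite EM2; apply: scales_lebesgue_comp.
  apply: scales_lebesgue_comp; first exact: scales_lebesgue_upper.
  by apply: scales_lebesgue_lower => u; exact: IH.
have -> : 0 = col_mx (const_mx 0) 0 :> 'cV[R]_(1 + n).
  by rewrite [const_mx 0](_ : _ = 0) ?col_mx0//; apply/matrixP => i j; rewrite !mxE.
exact: scales_lebesgue_upper (oner_neq0 _).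
Qed.

End AffineChange.

(** * Hyperplanes and the standard simplex *)

Section NullAndSimplex.
Variable R : realType.
Local Notation RR := (measurableTypeR R).

Lemma measurable_col_form n (g : 'rV[R]_n) c (B : set RR) : measurable B ->
  measurable_col [set y | B ((g *m y) 0 0 + c)].
Proof.
move=> mB; rewrite /measurable_col -[X in measurable X]setTI.
exact: (measurable_linear_form g c).
Qed.

(** If the first coefficient is nonzero, each line parallel to the first axis
    meets the hyperplane in one point; otherwise each slice is a hyperplane of
    lower dimension. *)
Lemma hyperplane_null n (g : 'rV[R]_n) (c : R) : g != 0 ->
  lebesgue_col [set y | (g *m y) 0 0 + c = 0] = 0%E.
Proof.
elim: n g c => [|n IH] g c g0; first by rewrite (thinmx0 g) eqxx in g0.
pose h : R := @lsubmx R 1 1 n g 0 0; pose g' := @rsubmx R 1 1 n g.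
have gE : g = row_mx h%:M g' :> 'rV[R]_(1 + n).
  by rewrite -[LHS](@hsubmxK _ _ 1 n g); congr row_mx; exact: mx11_scalar.
have Eg x y : (g *m vcons x y) 0 0 + c = h * x + ((g' *m y) 0 0 + c).
  transitivity ((row_mx h%:M g' *m col_mx (const_mx x) y) 0 0 + c).
    by rewrite -gE.
  by rewrite mul_row_col mxE mul_scalar_mx !mxE addrA.
have [h0|h0] := eqVneq h 0.
  have g'0 : g' != 0.
    by apply: contra g0 => /eqP g'0; rewrite gE g'0 h0 raddf0 row_mx0.
  rewrite lebesgue_col_slice; apply: integral0_eq => x _.
  rewrite -[RHS](IH g' c g'0); congr lebesgue_col; apply/seteqP.
  by split => y /=; rewrite Eg h0 mul0r add0r.
rewrite lebesgue_col_line; last first.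
  exact: (measurable_col_form _ _ (measurable_set1 0)).
apply: integral0_eq => t _; set y := col_of_tuple t.
rewrite -[RHS](@lebesgue_measure_set1 R (- ((g' *m y) 0 0 + c) / h)).
congr lebesgue_measure; apply/seteqP; split=> x /=; rewrite Eg => /eqP.
  by rewrite addr_eq0 => /eqP <-; rewrite mulrC mulKf.
by move=> /eqP ->; rewrite mulrC divfK// addNr.
Qed.

Definition corner n (r : R) : set 'cV[R]_n :=
  [set z | (forall i, 0 < z i 0) /\ \sum_i z i 0 < r].

Lemma measurable_corner n r : measurable_col (@corner n r).
Proof.
have -> : @corner n r = [set z : 'cV[R]_n | forall i, 0 < z i 0] `&`
    [set z | `]-oo, r[%classic (((const_mx 1 : 'rV[R]_n) *m z) 0 0 + 0)].
  have e (z : 'cV[R]_n) : ((const_mx 1 : 'rV[R]_n) *m z) 0 0 = \sum_i z i 0.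
    by rewrite mxE; apply: eq_bigr => i _; rewrite mxE mul1r.
  by apply/seteqP; split => z /=; rewrite in_itv /= addr0 e.
rewrite /measurable_col preimage_setI; apply: measurableI.
  have -> : @col_of_tuple R n @^-1` [set z | forall i, 0 < z i 0] =
      \bigcap_(i in [set: 'I_n]) (@col_of_tuple R n @^-1`
        [set z | (`]0, +oo[%classic : set R) (((delta_mx 0 i : 'rV[R]_n) *m z) 0 0 + 0)]).
    apply/seteqP; split => t /=.
      by move=> h i _ /=; rewrite in_itv /= andbT addr0 -rowE mxE.
    by move=> h i; have /= := h i I; rewrite in_itv /= andbT addr0 -rowE mxE.
  apply: fin_bigcap_measurable => // i _.
  exact: (measurable_col_form (delta_mx 0 i) 0 (measurable_itv `]0, +oo[)).
exact: (measurable_col_form (const_mx 1) 0 (measurable_itv `]-oo, r[)).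
Qed.

Lemma integral_corner n (r : R) : 0 < r ->
  (\int[@lebesgue_measure R]_(x in `]0%R, r[) ((r - x) ^+ n / n`!%:R)%:E
   = (r ^+ n.+1 / n.+1`!%:R)%:E)%E.
Proof.
move=> r0.
pose P : {poly R} := (- (n.+1`!%:R)^-1) *: (r%:P - 'X) ^+ n.+1.
have P' x : P^`().[x] = (r - x) ^+ n / n`!%:R.
  rewrite /P derivZ deriv_exp derivB derivC derivX /= sub0r !hornerE.
  rewrite hornerMn !hornerE /= factS natrM.
  have : n`!%:R != 0 :> R by rewrite pnatr_eq0 -lt0n fact_gt0.
  have : n.+1%:R != 0 :> R by rewrite pnatr_eq0.
  rewrite -mulr_natr => h1 h2; field; exact/andP.
under eq_integral => x _ do rewrite -P'.
rewrite -(@integral_itv_bndoo _ _ _ _ true false); last first.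
  apply/measurable_EFinP; apply: measurable_funTS;
  apply: continuous_measurable_fun; exact: continuous_horner.
rewrite (@continuous_FTC2 _ _ (horner P))//.
- rewrite /P !hornerE subrr subr0 expr0n /= mulr0 -EFinB; congr EFin.
  by rewrite sub0r mulNr opprK mulrC.
- by apply: continuous_subspaceT => x; exact: continuous_horner.
- split.
  + by move=> x _; have [] := is_derive_poly P x.
  + by apply: cvg_at_right_filter; exact: continuous_horner.
  + by apply: cvg_at_left_filter; exact: continuous_horner.
- by move=> x _; rewrite derive1E; have [_ ->] := is_derive_poly P x.
Qed.

(** Slicing at the first coordinate [x] leaves the corner of size [r - x], which
    is why the size is kept general in the induction. *)
Lemma lebesgue_corner n (r : R) : 0 < r ->
  lebesgue_col (@corner n r) = (r ^+ n / n`!%:R)%:E.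
Proof.
elim: n r => [|n IH] r r0.
  rewrite /lebesgue_col /= diracE expr0 fact0 divr1 mem_set//=; split.
    by case.
  by rewrite big_ord0.
rewrite lebesgue_col_slice -integral_corner// [RHS]integral_mkcond.
apply: eq_integral => x _; rewrite patchE.
have Ev (y : 'cV[R]_n) : corner r (vcons x y) <-> 0 < x /\ corner (r - x) y.
  rewrite /corner /vcons /=.
  rewrite [X in _ /\ X < _](_ : _ = x + \sum_i y i 0); last first.
    rewrite (@big_split_ord _ _ _ 1 n) /= big_ord1 col_mxEu mxE; congr (_ + _).
    by apply: eq_bigr => i _; rewrite col_mxEd.
  rewrite ltrBrDl; split => [[h s]|[x0 [h s]]].
    split; first by have := h (lshift n ord0); rewrite col_mxEu mxE.
    by split => // i; have := h (rshift 1 i); rewrite col_mxEd.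
  split => // i; rewrite -[i]/(i : 'I_(1 + n)).
  by case: (split_ordP i) => j ->; rewrite (col_mxEu, col_mxEd)// mxE.
case: ifPn => [|]; rewrite ?notin_setE ?inE /= in_itv /=.
  move=> /andP[x0 xr]; rewrite -IH ?subr_gt0//; congr lebesgue_col.
  apply/seteqP; split => [y /Ev[]//|y cy]; exact/Ev.
move=> h; rewrite (_ : [set y | _] = set0) ?/lebesgue_col ?preimage_set0 ?measure0//.
apply/seteqP; split => // y /Ev [x0 [y0 yr]]; apply: h; rewrite x0 /=.
by rewrite -subr_gt0 (le_lt_trans _ yr)// sumr_ge0// => i _; exact: ltW.
Qed.

End NullAndSimplex.

(** * Barycentric coordinates *)

Section Barycentric.
Variables (R : realType) (d : nat).
Implicit Types (K S F : {fset 'cV[R]_d}) (x y u v : 'cV[R]_d).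

(** A column number of [vertex_mx K]; it lets coordinates be indexed by vertices.
    Its value is meaningful only for [v] in a [K] with [d.+1] elements. *)
Definition vindex K v : 'I_(d + 1) :=
  cast_ord (esym (addn1 d)) (inord (index v (enum_fset K))).

Definition bary K x : 'cV[R]_(d + 1) := bary_weight K *m x + bary_bias K.

Definition bcoord K v x : R := bary K x (vindex K v) 0.

Definition bgrad K v : 'rV[R]_d := row (vindex K v) (bary_weight K).

Lemma bcoordE K v x :
  bcoord K v x = (bgrad K v *m x) 0 0 + bary_bias K (vindex K v) 0.
Proof. by rewrite /bcoord /bary mxE /bgrad -row_mul [in RHS]mxE. Qed.

Lemma bcoordB K v x y : bcoord K v x - bcoord K v y = (bgrad K v *m (x - y)) 0 0.
Proof.
by rewrite !bcoordE opprD addrACA subrr addr0 mulmxBr [in RHS]mxE [X in _ = _ + X]mxE.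
Qed.

Lemma baryE K x : bary K x = invmx (vertex_mx K) *m col_mx x (const_mx 1).
Proof.
rewrite -[invmx _]hsubmxK mul_row_col /bary; congr (_ + _).
by rewrite [const_mx 1]mx11_scalar mxE mulmx1.
Qed.

Lemma sum_nth_fset (V : nmodType) K (f : 'cV[R]_d -> V) : #|` K| = d.+1 ->
  \sum_(v <- K) f v = \sum_(j < d + 1) f (nth 0 (enum_fset K) j).
Proof. by move=> cK; rewrite (big_nth 0) big_mkord cK addn1. Qed.

Lemma nth_vindex K v : #|` K| = d.+1 -> v \in K ->
  nth 0 (enum_fset K) (vindex K v) = v.
Proof.
by move=> cK vK; rewrite /= inordK ?nth_index// -cK index_mem.
Qed.

Lemma vindex_nth K (j : 'I_(d + 1)) : #|` K| = d.+1 ->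
  vindex K (nth 0 (enum_fset K) j) = j.
Proof.
move=> cK; apply: val_inj; have jK : (j < #|` K|)%N by rewrite cK -(addn1 d).
by rewrite /= index_uniq ?fset_uniq// inordK// -cK.
Qed.

Lemma vertex_mx_mul K (l : 'cV[R]_d -> R) : #|` K| = d.+1 ->
  vertex_mx K *m (\col_j l (nth 0 (enum_fset K) j))
  = col_mx (\sum_(v <- K) l v *: v) (const_mx (\sum_(v <- K) l v)).
Proof.
move=> cK; rewrite /vertex_mx mul_col_mx; congr col_mx.
  apply/matrixP => i k; rewrite ord1 mxE (sum_nth_fset _ cK) summxE.
  by apply: eq_bigr => j _; rewrite !mxE mulrC.
apply/matrixP => i k; rewrite !mxE (sum_nth_fset _ cK).
by apply: eq_bigr => j _; rewrite !mxE mul1r.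
Qed.

(** A kernel vector of the matrix is an affine dependence between the vertices. *)
Lemma vertex_mx_unit K : is_simplex d K -> vertex_mx K \in unitmx.
Proof.
move=> [cK aK]; rewrite -unitmx_tr -row_free_unit; apply: inj_row_free => w hw.
pose l v := w 0 (vindex K v).
have wE : w^T = \col_j l (nth 0 (enum_fset K) j).
  by apply/matrixP => i k; rewrite !mxE /l vindex_nth// ord1.
have : vertex_mx K *m w^T = 0.
  by rewrite -[vertex_mx K]trmxK -trmx_mul hw trmx0.
rewrite wE vertex_mx_mul// => h.
have h1 : \sum_(v <- K) l v = 0.
  by move/(congr1 dsubmx)/matrixP/(_ 0 0): h; rewrite col_mxKd !mxE.
have h2 : \sum_(v <- K) l v *: v = 0.
  by move/(congr1 usubmx): h; rewrite col_mxKu linear0.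
apply/matrixP => i j; rewrite ord1 mxE -(vindex_nth j cK); apply: (aK l) => //.
by apply: mem_nth; rewrite cK -(addn1 d).
Qed.

Lemma sum_delta K (V : lmodType R) (f : 'cV[R]_d -> V) u : u \in K ->
  \sum_(v <- K) (u == v)%:R *: f v = f u.
Proof.
move=> uK; rewrite (big_fsetD1 u)//= eqxx scale1r big1_fset ?addr0// => v.
by rewrite !inE => /andP[/negbTE vu _] _; rewrite eq_sym vu scale0r.
Qed.

Section Simplex.
Variable K : {fset 'cV[R]_d}.
Hypothesis sK : is_simplex d K.
Let cK : #|` K| = d.+1. Proof. by case: sK. Qed.

Lemma bcoord_uniq (l : 'cV[R]_d -> R) x : \sum_(v <- K) l v = 1 ->
  x = \sum_(v <- K) l v *: v -> forall v, v \in K -> bcoord K v x = l v.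
Proof.
move=> l1 xE v vK; rewrite /bcoord baryE.
have -> : col_mx x (const_mx 1) =
    vertex_mx K *m \col_j l (nth 0 (enum_fset K) j).
  by rewrite vertex_mx_mul// -xE l1.
by rewrite mulKmx ?vertex_mx_unit// mxE nth_vindex.
Qed.

Lemma sum_bcoord_mx x : vertex_mx K *m (\col_j bcoord K (nth 0 (enum_fset K) j) x) =
  col_mx x (const_mx 1).
Proof.
rewrite -[RHS](mulKVmx (vertex_mx_unit sK)) -baryE; congr (_ *m _).
by apply/matrixP => i j; rewrite ord1 mxE /bcoord vindex_nth.
Qed.

Lemma sum_bcoord x : \sum_(v <- K) bcoord K v x = 1.
Proof.
have := sum_bcoord_mx x; rewrite (vertex_mx_mul (fun v => bcoord K v x))//.
by move/(congr1 dsubmx)/matrixP/(_ 0 0); rewrite !col_mxKd !mxE.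
Qed.

Lemma sum_bcoord_vertex x : \sum_(v <- K) bcoord K v x *: v = x.
Proof.
have := sum_bcoord_mx x; rewrite (vertex_mx_mul (fun v => bcoord K v x))//.
by move/(congr1 usubmx); rewrite !col_mxKu.
Qed.

Lemma bcoord_vertex u v : u \in K -> v \in K -> bcoord K v u = (u == v)%:R.
Proof.
move=> uK vK; apply: (bcoord_uniq (l := fun v => (u == v)%:R)) => //.
  have := sum_delta (fun=> 1 : R^o) uK.
  by under eq_bigr do rewrite /GRing.scale/= mulr1.
by rewrite sum_delta.
Qed.

Lemma open_hullP x : open_hull K x <-> forall v, v \in K -> 0 < bcoord K v x.
Proof.
split=> [[l [l0 l1 xE]] v vK|h]; first by rewrite (bcoord_uniq l1 xE)// l0.
by exists (fun v => bcoord K v x); split; rewrite ?sum_bcoord ?sum_bcoord_vertex.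
Qed.

Lemma bcoord_continuous v : continuous (bcoord K v).
Proof.
have -> : bcoord K v =
    fun x => \sum_j bgrad K v 0 j * x j 0 + bary_bias K (vindex K v) 0.
  by apply/funext => x; rewrite bcoordE mxE.
move=> x; apply: (@cvgD _ _ _ (nbhs x)); last exact: cvg_cst.
apply: (@cvg_big _ _ _ _ _ _ _ (nbhs x)) => [|j _]; first exact: add_continuous.
apply: (@cvgM _ _ (nbhs x)); first exact: cvg_cst.
exact: coord_continuous.
Qed.

Lemma bcoord_sub S (l : 'cV[R]_d -> R) x : (S `<=` K)%fset ->
  \sum_(v <- S) l v = 1 -> x = \sum_(v <- S) l v *: v ->
  forall v, v \in K -> bcoord K v x = if v \in S then l v else 0.
Proof.
move=> SK l1 xE.
apply: (bcoord_uniq (l := fun v => if v \in S then l v else 0)).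
  rewrite -{}l1 -(big_fset_incl _ SK); last by move=> v _ /negbTE ->.
  by apply: eq_big_seq => v ->.
rewrite {}xE -(big_fset_incl _ SK); last first.
  by move=> v _ /negbTE ->; rewrite scale0r.
by apply: eq_big_seq => v ->.
Qed.

(** Membership in the open hull of a subsimplex, read off the barycentric
    coordinates of the big simplex: this treats faces and elements uniformly. *)
Lemma subhullP S x : (S `<=` K)%fset -> open_hull S x <->
  (forall v, v \in S -> 0 < bcoord K v x) /\
  (forall v, v \in K -> v \notin S -> bcoord K v x = 0).
Proof.
move=> SK; split=> [[l [l0 l1 xE]]|[h1 h2]].
  split=> v vS; first by rewrite (bcoord_sub SK l1 xE) ?(fsubsetP SK)// vS l0.
  by move=> /negbTE vS'; rewrite (bcoord_sub SK l1 xE) ?vS'.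
exists (fun v => bcoord K v x); split=> //.
  by rewrite -[RHS](sum_bcoord x) (big_fset_incl _ SK).
rewrite -[LHS](sum_bcoord_vertex x) -(big_fset_incl _ SK)// => v vK vS.
by rewrite h2// scale0r.
Qed.

(** By continuity of the coordinates, the conditions defining the open hull pass
    to the closure with weak inequalities. *)
Lemma closure_subhull S x : (S `<=` K)%fset -> closure (open_hull S) x ->
  forall v, v \in K -> 0 <= bcoord K v x /\ (v \notin S -> bcoord K v x = 0).
Proof.
move=> SK xS v vK.
have cl (B : set R) : closed B -> (forall y, open_hull S y -> B (bcoord K v y)) ->
    B (bcoord K v x).
  move=> cB hB.
  have : closed (bcoord K v @^-1` B).
    exact: (continuous_closedP _).1 (@bcoord_continuous v) _ cB.
  by apply; apply: closureS xS => y /hB.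
split.
  apply: (cl [set z | 0 <= z]); first exact: closed_ge.
  move=> y /(subhullP _ SK)[h1 h2] /=.
  by have [/h1/ltW//|/(h2 _ vK)->] := boolP (v \in S).
move=> vS; apply: (cl [set z | z = 0]); first exact: closed_eq.
by move=> y /(subhullP _ SK)[_ ] /(_ _ vK vS).
Qed.

End Simplex.

Lemma hull_center S : S != fset0 -> exists x, open_hull S x.
Proof.
move=> S0; pose l (v : 'cV[R]_d) : R := #|` S|%:R^-1.
have cS : (0 < #|` S|)%N by rewrite cardfs_gt0.
exists (\sum_(v <- S) l v *: v); exists l; split=> //.
  by move=> v _; rewrite invr_gt0 ltr0n.
rewrite /l big_const_seq count_predT iter_addr_0 -[LHS]mulr_natr.
by rewrite mulVf// pnatr_eq0 -lt0n.
Qed.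

Lemma hull_segment S x v (t : R) : open_hull S x -> v \in S -> 0 < t <= 1 ->
  open_hull S (v + t *: (x - v)).
Proof.
move=> [l [l0 l1 xE]] vS /andP[t0 t1].
pose l' w := t * l w + (1 - t) * (v == w)%:R.
exists l'; split.
- move=> w wS; rewrite ltr_pwDl// ?mulr_gt0 ?l0// mulr_ge0// subr_ge0//.
- rewrite big_split/= -!mulr_sumr l1.
  have := sum_delta (fun=> 1 : R^o) vS; under eq_bigr do rewrite /GRing.scale/= mulr1.
  by move=> ->; rewrite !mulr1 addrC subrK.
under eq_bigr do rewrite scalerDl -2!scalerA.
rewrite big_split/= -!scaler_sumr -xE sum_delta//.
by rewrite scalerBr scalerBl scale1r addrCA.
Qed.

Lemma segment_closure (A : set 'cV[R]_d) x y :
  (forall t : R, 0 < t -> t <= 1 -> A (x + t *: (y - x))) -> closure A x.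
Proof.
move=> hA B Bx.
have cphi : x + t *: (y - x) @[t --> (0:R)] --> x.
  rewrite -[X in _ --> X]addr0; apply: cvgD; first exact: cvg_cst.
  rewrite -[X in _ --> X](scale0r (y - x)); apply: cvgZr_tmp.
  exact: cvg_id.
have nB : \forall t \near (0:R)^'+, B (x + t *: (y - x)).
  by apply: cvg_within; exact: cphi.
near (0:R)^'+ => t.
exists (x + t *: (y - x)); split; last by near: t.
by apply: hA; near: t; [exact: nbhs_right_gt|exact: nbhs_right_le].
Unshelve. all: by end_near. Qed.

Lemma vertex_closure S v : v \in S -> closure (open_hull S) v.
Proof.
move=> vS; have [x xS] : exists x, open_hull S x.
  by apply: hull_center; apply/fset0Pn; exists v.
apply: (segment_closure (y := x)) => t t0 t1.
by apply: hull_segment; rewrite ?t0.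
Qed.

(** Normals and affine hulls are specified through points of open hulls, which
    in general contain no vertex; this transfers such information to the vertices. *)
Lemma hull_diff S u v : u \in S -> v \in S ->
  exists x y, [/\ open_hull S x, open_hull S y & x - y = 2^-1 *: (u - v)].
Proof.
move=> uS vS; have [x xS] : exists x, open_hull S x.
  by apply: hull_center; apply/fset0Pn; exists v.
have h : 0 < (2^-1 : R) <= 1.
  by lra.
(* The two points half way from a common hull point x to the vertices. *)
exists (u + 2^-1 *: (x - u)), (v + 2^-1 *: (x - v)).
split; try exact: hull_segment.
by apply/matrixP => i j; rewrite !mxE; field.
Qed.

Lemma bcoord_segment K v x y (t : R) :
  bcoord K v (x + t *: (y - x)) = bcoord K v x + t * (bcoord K v y - bcoord K v x).
Proof.
rewrite -[LHS](subrK (bcoord K v x)) !bcoordB [LHS]addrC; congr (_ + _).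
by rewrite addrAC subrr add0r -scalemxAr mxE.
Qed.

Lemma apex_exists K F : #|` K| = d.+1 -> (F `<=` K)%fset -> #|` F| = d ->
  exists2 a, a \in K & a \notin F.
Proof.
move=> cK FK cF; have : (K `\` F)%fset != fset0.
  by rewrite -cardfs_gt0 cardfsDS// cK cF subSnn.
by case/fset0Pn => a; rewrite inE => /andP[aF aK]; exists a.
Qed.

Lemma apexE K F a : #|` K| = d.+1 -> (F `<=` K)%fset -> #|` F| = d ->
  a \in K -> a \notin F -> K = (a |` F)%fset.
Proof.
move=> cK FK cF aK aF; apply/eqP.
rewrite eq_sym eqEfcard cardfsU1 aF cF cK leqnn andbT.
by rewrite fsubUset fsub1set aK.
Qed.

Lemma subhull_closure K S : is_simplex d K -> (S `<=` K)%fset ->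
  open_hull S `<=` closure (open_hull K).
Proof.
move=> sK SK x xS; have [y yK] : exists y, open_hull K y.
  by apply: hull_center; rewrite -cardfs_gt0 sK.1.
have clx := closure_subhull sK SK (subset_closure xS).
apply: (segment_closure (y := y)) => t t0 t1; apply/(open_hullP sK) => v vK.
rewrite bcoord_segment mulrBr addrCA -[X in _ + (X - _)]mul1r -mulrBl.
rewrite ltr_pwDl ?mulr_gt0 ?(open_hullP sK y).1//.
by rewrite mulr_ge0 ?subr_ge0// (clx v vK).1.
Qed.

End Barycentric.

(** * Volume of a simplex and area of its faces *)

Section Householder.
Variable R : realType.

(** The Householder reflection in the bisector of [n] and the first basis vector. *)
Lemma reflection_to_unit m (n : 'cV[R]_(1 + m)) : n^T *m n = 1%:M ->
  exists H : 'M[R]_(1 + m), H^T *m H = 1%:M /\ lsubmx H = n.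
Proof.
move=> nn; pose e : 'cV[R]_(1 + m) := col_mx 1%:M 0.
have ee : e^T *m e = 1%:M.
  by rewrite /e tr_col_mx mul_row_col trmx1 mulmx1 mulmx0 addr0.
have [->|ne] := eqVneq n e.
  exists 1%:M; split; first by rewrite trmx1 mulmx1.
  by rewrite [1%:M]scalar_mx_block block_mxEh row_mxKl.
pose w := n - e; pose a := (w^T *m w) 0 0.
have aE : w^T *m w = a%:M by rewrite [LHS]mx11_scalar.
have a0 : a != 0.
  apply: contra ne => /eqP; rewrite /a mxE => /eqP.
  rewrite psumr_eq0 => [/allP h|i _]; last by rewrite mxE -expr2 sqr_ge0.
  rewrite -subr_eq0 -/w; apply/eqP/matrixP => i j.
  rewrite ord1 [RHS]mxE; apply/eqP.
  by have := h i; rewrite mem_index_enum mxE mulf_eq0 orbb => /(_ isT).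
pose H : 'M[R]_(1 + m) := 1%:M - (2 / a) *: (w *m w^T).
have Ht : H^T = H by rewrite /H linearB /= trmx1 linearZ /= trmx_mul trmxK.
exists H; rewrite Ht; split.
  rewrite /H mulmxBl mul1mx mulmxBr mulmx1 -scalemxAl -scalemxAr scalerA.
  rewrite mulmxA -(mulmxA w) aE -mulmxA mul_scalar_mx -!scalemxAr.
  by rewrite scalerA; apply/matrixP => i j; rewrite !mxE; field.
have -> : lsubmx H = H *m e.
  by rewrite -{2}[H]hsubmxK /e mul_row_col mulmx1 mulmx0 addr0.
have wT : w^T = n^T - e^T by rewrite /w linearB.
have we : w^T *m e = (- (a / 2))%:M.
  have nte : e^T *m n = n^T *m e.
    by rewrite -[LHS]trmxK trmx_mul trmxK [n^T *m e]mx11_scalar tr_scalar_mx.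
  have : w^T *m w = 2%:M - (n^T *m e) *+ 2.
    rewrite wT /w mulmxBl !mulmxBr nn ee nte.
    by apply/matrixP => i j; rewrite !ord1 !mxE !mulr1n; ring.
  rewrite aE wT mulmxBl ee => /matrixP/(_ 0 0) h.
  apply/matrixP => i j; rewrite !ord1; move: h; rewrite !mxE !mulr1n => ->.
  by field.
rewrite /H mulmxBl mul1mx -scalemxAl -mulmxA we mul_mx_scalar scalerA.
rewrite (_ : _ * - _ = -1); last by field.
by rewrite scaleN1r opprK addrC subrK.
Qed.

Lemma orthonormal_complement m (n : 'cV[R]_(1 + m)) : n^T *m n = 1%:M ->
  exists U : 'M[R]_(1 + m, m),
    [/\ U^T *m U = 1%:M, n^T *m U = 0 & n *m n^T + U *m U^T = 1%:M].
Proof.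
move=> /reflection_to_unit[H [HH He]].
have HE : H = row_mx n (rsubmx H) by rewrite -He hsubmxK.
exists (rsubmx H); have HHt := mulmx1C HH.
move: HH HHt; rewrite {}HE row_mxKr tr_row_mx mul_col_row mul_row_col.
by rewrite scalar_mx_block => /eq_block_mx[_ h1 _ h2].
Qed.

End Householder.

Lemma normr_det_orthogonal (R : realType) n (W : 'M[R]_n) :
  W^T *m W = 1%:M -> `|\det W| = 1.
Proof.
move=> h; have : \det W ^+ 2 = 1 by rewrite expr2 -{1}det_tr -det_mulmx h det1.
by move=> /eqP; rewrite sqrf_eq1 => /pred2P[] ->; rewrite ?normrN1 ?normr1.
Qed.

(** The measure is a choice among the values obtained in all orthonormal
    coordinates, so it is known once all of them agree and there is one. *)
Lemma kmeasureE (R : realType) (d k : nat) (A : set 'cV[R]_d) (v : \bar R) :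
  (exists (U : 'M[R]_(d, k)) p,
     U^T *m U = 1%:M /\ A `<=` range (fun y => U *m y + p)) ->
  (forall (U : 'M[R]_(d, k)) p,
     U^T *m U = 1%:M -> A `<=` range (fun y => U *m y + p) ->
     lebesgue_col [set y | A (U *m y + p)] = v) ->
  kmeasure k A = fine v.
Proof.
move=> [U [p [UU Ap]]] h; rewrite /kmeasure.
set X := [set w | _].
have : X (xget 0%E X).
  by apply: (@xgetPex _ 0%E X); exists v, U, p; split => //; rewrite h.
by move=> [U' [p' [UU' Ap' ->]]]; rewrite h.
Qed.

(** In this section [b 0, ..., b m] are the vertices of the face [F] of the
    simplex [K], and [a] is the opposite vertex. The coordinates at [a] and at
    [b 1, ..., b m] map [K] to the standard simplex, with linear part
    [grad_all]; those at [b 1, ..., b m] alone do the same for [F] in its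
    hyperplane. *)
Section SimplexMeasure.
Variables (R : realType) (m : nat).
Let d := m.+1.
Variables (K F : {fset 'cV[R]_d}) (a : 'cV[R]_d).
Hypothesis sK : is_simplex d K.
Hypothesis FK : (F `<=` K)%fset.
Hypothesis cF : #|` F| = d.
Hypothesis aK : a \in K.
Hypothesis aF : a \notin F.

Let cK : #|` K| = d.+1. Proof. by case: sK. Qed.

Let b (i : 'I_m.+1) : 'cV[R]_d := nth 0 (enum_fset F) i.
Let bF i : b i \in F. Proof. by apply: mem_nth; rewrite cF. Qed.
Let bK i : b i \in K. Proof. exact: (fsubsetP FK). Qed.
Let b_inj i j : (b i == b j) = (i == j).
Proof. by rewrite nth_uniq ?cF ?fset_uniq. Qed.
Let ab i : (a == b i) = false.
Proof. by apply/negbTE; apply: contra aF => /eqP ->. Qed.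

Let KE : K = (a |` F)%fset. Proof. exact: apexE. Qed.

Let sumF (V : nmodType) (f : 'cV[R]_d -> V) :
  \sum_(v <- F) f v = f (b ord0) + \sum_(i < m) f (b (lift ord0 i)).
Proof. by rewrite (big_nth 0) big_mkord cF big_ord_recl. Qed.

Let inF v : v \in F -> exists i, v = b i.
Proof.
move=> vF; have vi : (index v (enum_fset F) < m.+1)%N.
  by rewrite -[m.+1]cF index_mem.
by exists (Ordinal vi); rewrite /b /= nth_index.
Qed.

Definition grad_rest : 'M[R]_(m, d) :=
  \matrix_(i, j) bgrad K (b (lift ord0 i)) 0 j.
Definition bias_rest : 'cV[R]_m :=
  \col_i bary_bias K (vindex K (b (lift ord0 i))) 0.
Definition grad_all : 'M[R]_(1 + m) := col_mx (bgrad K a) grad_rest.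
(** The edges of the face leaving [b 0]: a right inverse of [grad_rest]. *)
Definition edges : 'M[R]_(d, m) := \matrix_(i, j) (b (lift ord0 j) - b ord0) i 0.

Let restE x i : (grad_rest *m x + bias_rest) i 0 = bcoord K (b (lift ord0 i)) x.
Proof.
rewrite bcoordE 2!mxE [X in _ + X = _]mxE; congr (_ + _); rewrite mxE.
by apply: eq_bigr => j _; rewrite mxE.
Qed.

Lemma grad_edges : grad_rest *m edges = 1%:M.
Proof.
apply/matrixP => i j.
transitivity (bcoord K (b (lift ord0 i)) (b (lift ord0 j))
              - bcoord K (b (lift ord0 i)) (b ord0)).
  by rewrite bcoordB !mxE; apply: eq_bigr => k _; rewrite !mxE.
rewrite !bcoord_vertex// !b_inj (inj_eq lift_inj) -(inj_eq val_inj) /=.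
by rewrite subr0 mxE eq_sym.
Qed.

Lemma grad_apex_edges : bgrad K a *m edges = 0.
Proof.
apply/matrixP => i j; rewrite ord1.
transitivity (bcoord K a (b (lift ord0 j)) - bcoord K a (b ord0)).
  by rewrite bcoordB !mxE; apply: eq_bigr => k _; rewrite !mxE.
by rewrite !bcoord_vertex// ![_ == a]eq_sym !ab subrr mxE.
Qed.

Lemma open_hull_corner x :
  open_hull K x <->
  corner 1 (grad_all *m x
            + col_mx (const_mx (bary_bias K (vindex K a) 0)) bias_rest).
Proof.
have e : grad_all *m x
    + col_mx (const_mx (bary_bias K (vindex K a) 0)) bias_rest
  = col_mx (const_mx (bcoord K a x)) (\col_i bcoord K (b (lift ord0 i)) x).
  rewrite mul_col_mx add_col_mx; congr col_mx.
    apply/matrixP => i j.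
    by rewrite !ord1 mxE bcoordE [X in _ + X = _]mxE [RHS]mxE.
  by apply/matrixP => i j; rewrite !ord1 restE mxE.
have := sum_bcoord sK x; rewrite {1}KE big_fsetU1//= sumF addrCA => s1.
rewrite e (open_hullP sK); split => [h|[h1 h2]].
  split => [i|].
    by case: (split_ordP i) => j ->; rewrite (col_mxEu, col_mxEd)// mxE h.
  rewrite big_split_ord /= big_ord1 col_mxEu mxE.
  under eq_bigr do rewrite col_mxEd mxE.
  by rewrite -s1 ltrDr h.
have ha : 0 < bcoord K a x by have := h1 (lshift m ord0); rewrite col_mxEu mxE.
have hi i : 0 < bcoord K (b (lift ord0 i)) x.
  by have := h1 (rshift 1 i); rewrite col_mxEd mxE.
have h0 : 0 < bcoord K (b ord0) x.
  move: h2; rewrite big_split_ord /= big_ord1 col_mxEu mxE.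
  under eq_bigr do rewrite col_mxEd mxE.
  by rewrite -s1 ltrDr.
move=> v; rewrite {1}KE !inE => /orP[/eqP->//|/inF[i ->]].
by case: (unliftP ord0 i) => [j ->|->].
Qed.

Lemma face_corner x : bcoord K a x = 0 ->
  open_hull F x <-> corner 1 (grad_rest *m x + bias_rest).
Proof.
move=> ax; have := sum_bcoord sK x; rewrite {1}KE big_fsetU1//= sumF ax add0r => s1.
rewrite (subhullP sK _ FK); split => [[h _]|[h1 h2]].
  split => [i|]; first by rewrite restE h.
  by under eq_bigr do rewrite restE; rewrite -s1 ltrDr h.
split=> [v /inF[i ->]|v]; last first.
  by rewrite {1}KE !inE => /orP[/eqP->//|->].
case: (unliftP ord0 i) => [j ->|->]; first by rewrite -restE.
by move: h2; under eq_bigr do rewrite restE; rewrite -s1 ltrDr.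
Qed.

Lemma det_grad_all : \det grad_all != 0.
Proof.
have : grad_all *m row_mx (a - b ord0) edges = 1%:M.
  rewrite mul_col_row grad_edges grad_apex_edges scalar_mx_block; congr block_mx.
    apply/matrixP => i j.
    rewrite !ord1 -bcoordB !bcoord_vertex// eqxx [_ == a]eq_sym ab.
    by rewrite subr0 !mxE.
  apply/matrixP => i j; rewrite ord1 [RHS]mxE.
  transitivity (bcoord K (b (lift ord0 i)) a - bcoord K (b (lift ord0 i)) (b ord0)).
    by rewrite bcoordB !mxE; apply: eq_bigr => k _; rewrite !mxE.
  by rewrite !bcoord_vertex// ab b_inj subrr.
by move=> /mulmx1_unit[]; rewrite unitmxE unitfE.
Qed.

Lemma lebesgue_simplex (U : 'M[R]_d) p : U^T *m U = 1%:M ->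
  lebesgue_col [set y | open_hull K (U *m y + p)] =
  ((`|\det grad_all| * d`!%:R)^-1)%:E.
Proof.
move=> UU;   pose q : 'cV[R]_(1 + m) :=
    col_mx (const_mx (bary_bias K (vindex K a) 0)) bias_rest.
have -> : [set y | open_hull K (U *m y + p)] =
    [set y | corner 1 ((grad_all *m U) *m y + (grad_all *m p + q))].
  apply/seteqP; split=> y /=; rewrite -mulmxA addrA -mulmxDr.
    by move/open_hull_corner.
  by move=> ?; apply/open_hull_corner.
have uU : grad_all *m U \in unitmx.
  by rewrite unitmx_mul unitmxE unitfE det_grad_all (mulmx1_unit UU).2.
have := lebesgue_col_affine (grad_all *m p + q) uU
  (@measurable_corner R _ 1).
rewrite lebesgue_corner// expr1n div1r det_mulmx normrM (normr_det_orthogonal UU) mulr1.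
move=> h; rewrite invfM EFinM -h muleA -EFinM mulVf ?mul1e//.
by rewrite normr_eq0 det_grad_all.
Qed.

Lemma kmeasure_simplex :
  kmeasure d (open_hull K) = (`|\det grad_all| * d`!%:R)^-1.
Proof.
rewrite (@kmeasureE _ _ _ _ ((`|\det grad_all| * d`!%:R)^-1)%:E)//.
  exists 1%:M, 0; split; first by rewrite trmx1 mulmx1.
  by move=> x _; exists x => //; rewrite mul1mx addr0.
by move=> U p UU _; exact: lebesgue_simplex.
Qed.

Section Normal.
Variable n : 'cV[R]_d.
Hypothesis un : unit_normal F n.

Let nn : n^T *m n = 1%:M.
Proof. by rewrite [LHS]mx11_scalar; congr _%:M; have [] := un. Qed.

Let F0 : F != fset0. Proof. by rewrite -cardfs_gt0 cF. Qed.

Let n_edges : n^T *m edges = 0.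
Proof.
apply/matrixP => i j; rewrite ord1 [RHS]mxE.
have [x [y [xF yF xy]]] := hull_diff (bF (lift ord0 j)) (bF ord0).
have := un.2 _ _ xF yF; rewrite xy /dot linearZ /= -scalemxAl mxE => /eqP.
rewrite mulf_eq0 invr_eq0 pnatr_eq0 /= => /eqP <-.
by rewrite !mxE; apply: eq_bigr => k _; rewrite !mxE mulrC.
Qed.

(* The coordinates U y + p cover the edges of F, and comparing dimensions they
   cover nothing else: the edge matrix in these coordinates is invertible. *)
Let plane_coord (U : 'M[R]_(d, m)) p : U^T *m U = 1%:M ->
  open_hull F `<=` range (fun y => U *m y + p) ->
  exists2 Z, Z \in unitmx & U *m Z = edges.
Proof.
move=> UU FU.
have UZ : U *m (U^T *m edges) = edges.
  suff [z <-] : exists z, U *m z = edges by rewrite (mulmxA U^T) UU mul1mx.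
  suff h j : exists z, U *m z = col j edges.
    have [z hz] := choice h; exists (\matrix_(i, j) z j i 0).
    apply/matrixP => i j; have /matrixP/(_ i 0) := hz j; rewrite [RHS]mxE => <-.
    by rewrite !mxE; apply: eq_bigr => k _; rewrite mxE.
  have [x [y [xF yF xy]]] := hull_diff (bF (lift ord0 j)) (bF ord0).
  have [x' _ xE] := FU _ xF; have [y' _ yE] := FU _ yF.
  exists (2 *: (x' - y')); rewrite -scalemxAr mulmxBr.
  have -> : U *m x' - U *m y' = x - y.
    by rewrite -xE -yE opprD addrACA subrr addr0.
  rewrite xy scalerA divff ?scale1r ?pnatr_eq0//.
  by apply/matrixP => i k; rewrite !mxE !ord1.
exists (U^T *m edges) => //.
have : (grad_rest *m U) *m (U^T *m edges) = 1%:M.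
  by rewrite -mulmxA UZ grad_edges.
by move=> /mulmx1_unit[].
Qed.

Let n_plane (U : 'M[R]_(d, m)) p : U^T *m U = 1%:M ->
  open_hull F `<=` range (fun y => U *m y + p) ->
  n^T *m U = 0 /\ bgrad K a *m U = 0.
Proof.
move=> UU FU; have [Z uZ UZ] := plane_coord UU FU.
split; apply: (can_inj (mulmxK uZ)); rewrite mul0mx -mulmxA UZ.
  exact: n_edges.
exact: grad_apex_edges.
Qed.

Let complement_range (U : 'M[R]_(d, m)) x0 : n *m n^T + U *m U^T = 1%:M ->
  open_hull F x0 -> open_hull F `<=` range (fun y => U *m y + x0).
Proof.
move=> nnUU x0F x xF; exists (U^T *m (x - x0)) => //.
have : (n *m n^T + U *m U^T) *m (x - x0) = x - x0 by rewrite nnUU mul1mx.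
rewrite mulmxDl -2!mulmxA (_ : n^T *m (x - x0) = 0) ?mulmx0 ?add0r.
  by move=> ->; rewrite subrK.
apply/matrixP => i j; rewrite !ord1 [RHS]mxE.
rewrite -[RHS](un.2 _ _ xF x0F) /dot !mxE.
by apply: eq_bigr => k _; rewrite !mxE mulrC.
Qed.

Let grad_normal : R := (bgrad K a *m n) 0 0.

(** The coordinate at [a] is constant on planes parallel to the face, so its
    gradient is a multiple of the normal. *)
Lemma grad_apexE : bgrad K a = grad_normal *: n^T.
Proof.
have [U [UU nU nnUU]] := orthonormal_complement nn.
have [x0 x0F] := hull_center F0.
have [_ gU] := n_plane UU (complement_range nnUU x0F).
rewrite -[LHS]mulmx1 -nnUU mulmxDr !mulmxA gU mul0mx addr0.
by rewrite [bgrad K a *m n]mx11_scalar mul_scalar_mx.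
Qed.

(** For coordinates [U] of the plane of [F], the matrix with columns [n] and [U]
    is orthogonal and makes [grad_all] block triangular, because the coordinate
    at [a] is constant along the face. Hence the determinants for [K] and [F]
    differ by the factor [grad_normal], up to sign the reciprocal of the
    height. *)
Lemma kmeasure_face :
  kmeasure m (open_hull F) =
  `|grad_normal| / (`|\det grad_all| * m`!%:R).
Proof.
have [x0 x0F] := hull_center F0.
rewrite (@kmeasureE _ _ _ _
  (`|grad_normal| / (`|\det grad_all| * m`!%:R))%:E)//.
  have [U [UU nU nnUU]] := orthonormal_complement nn.
  by exists U, x0; split => //; exact: complement_range.
move=> U p UU FU; have [nU gU] := n_plane UU FU.
have [Z uZ UZ] := plane_coord UU FU.
have uN : grad_rest *m U \in unitmx.
  have : (grad_rest *m U) *m Z = 1%:M by rewrite -mulmxA UZ grad_edges.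
  by move=> /mulmx1_unit[].
have a0 y : bcoord K a (U *m y + p) = 0.
  have [y0 _ y0E] := FU _ x0F.
  have l0 : bcoord K a x0 = 0 by apply: ((subhullP sK x0 FK).1 x0F).2.
  transitivity (bcoord K a (U *m y + p) - bcoord K a x0); first by rewrite l0 subr0.
  rewrite bcoordB -y0E.
  by rewrite opprD addrACA subrr addr0 -mulmxBr mulmxA gU mul0mx mxE.
have -> : [set y | open_hull F (U *m y + p)] =
    [set y | corner 1 ((grad_rest *m U) *m y + (grad_rest *m p + bias_rest))].
  apply/seteqP; split=> y /=; rewrite -mulmxA addrA -mulmxDr.
    by move/(face_corner (a0 y)).
  by move=> ?; apply/(face_corner (a0 y)).
have := lebesgue_col_affine (grad_rest *m p + bias_rest) uN
  (@measurable_corner R _ 1).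
rewrite lebesgue_corner// expr1n div1r => h.
have detN : `|\det grad_all| = `|grad_normal| * `|\det (grad_rest *m U)|.
  have WW : (row_mx n U)^T *m row_mx n U = 1%:M.
    rewrite tr_row_mx mul_col_row nn nU UU -[U^T *m n]trmxK trmx_mul trmxK nU.
    by rewrite trmx0 scalar_mx_block.
  have : grad_all *m row_mx n U =
      block_mx (bgrad K a *m n) 0 (grad_rest *m n) (grad_rest *m U).
    by rewrite mul_col_row gU.
  move/(congr1 (fun M => `|\det M|)); rewrite det_mulmx det_lblock !normrM.
  by rewrite (normr_det_orthogonal WW) mulr1 det_mx11.
have N0 : `|\det (grad_rest *m U)| != 0 by rewrite normr_eq0 -unitfE -unitmxE.
have g0 : `|grad_normal| != 0.
  by apply: contra det_grad_all => /eqP g0; rewrite -normr_eq0 detN g0 mul0r.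
move: h; set L := lebesgue_col _ => h.
rewrite detN -[L]mul1e -(mulVf N0) EFinM -muleA h -EFinM.
congr EFin; field; by rewrite N0 g0 pnatr_eq0 -lt0n fact_gt0.
Qed.

(** The identity volume = area * height / d in the form in which it enters the
    shape functions. *)
Lemma height_formula x : points_out_of K F n ->
  kmeasure d.-1 (open_hull F) * dot (x - a) n / (d%:R * kmeasure d (open_hull K))
  = 1 - bcoord K a x.
Proof.
move=> out; have [x0 x0F] := hull_center F0.
have [y yK] : exists y, open_hull K y.
  by apply: hull_center; rewrite -cardfs_gt0 cK.
have dotC u : dot u n = (n^T *m u) 0 0.
  by rewrite /dot !mxE; apply: eq_bigr => k _; rewrite !mxE mulrC.
have gN : grad_normal < 0.
  have : 0 < bcoord K a y by apply: (open_hullP sK y).1.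
  have l0 : bcoord K a x0 = 0 by apply: ((subhullP sK x0 FK).1 x0F).2.
  have -> : bcoord K a y = bcoord K a y - bcoord K a x0 by rewrite l0 subr0.
  rewrite bcoordB grad_apexE -scalemxAl mxE -dotC.
  by rewrite nmulr_lgt0// out.
have -> : 1 - bcoord K a x = - (bcoord K a x - bcoord K a a).
  by rewrite opprB; congr (_ - _); rewrite bcoord_vertex ?eqxx.
rewrite bcoordB {1}grad_apexE -scalemxAl mxE -dotC kmeasure_face kmeasure_simplex.
rewrite ltr0_norm// /= [d`!]factS natrM.
have d0 : d%:R != 0 :> R by rewrite pnatr_eq0.
have f0 : m`!%:R != 0 :> R by rewrite pnatr_eq0 -lt0n fact_gt0.
have D0 : `|\det grad_all| != 0 by rewrite normr_eq0 det_grad_all.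
rewrite -[m.+1]/d; move: (d%:R) d0 => e d0.
by field; rewrite D0 f0 d0.
Qed.

End Normal.

End SimplexMeasure.

(** * Elements adjacent to a face *)

Section SameSide.
Variables (R : realType) (d : nat).
Implicit Types (K L F : {fset 'cV[R]_d}).

Lemma bcoord_combination K L v x : is_simplex d L ->
  bcoord K v x = \sum_(u <- L) bcoord L u x * bcoord K v u.
Proof.
move=> sL; under eq_bigr do rewrite (bcoordE K) mulrDr.
rewrite big_split /= -mulr_suml sum_bcoord// mul1r bcoordE; congr (_ + _).
rewrite -{1}(sum_bcoord_vertex sL x) mulmx_sumr summxE.
by apply: eq_bigr => u _; rewrite -scalemxAr mxE.
Qed.

Lemma bgrad_neq0 K v : (0 < d)%N -> is_simplex d K -> v \in K -> bgrad K v != 0.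
Proof.
move=> d0 sK vK; have [cK _] := sK.
have [u uK uv] : exists2 u, u \in K & u != v.
  have : (K `\ v)%fset != fset0.
    by have := cardfsD1 v K; rewrite vK cK add1n -cardfs_gt0 => -[<-].
  by case/fset0Pn => u; rewrite !inE => /andP[uv uK]; exists u.
apply/eqP => g0; have := bcoordB K v v u.
rewrite g0 mul0mx [RHS]mxE !bcoord_vertex// eqxx (negbTE uv) subr0 => /eqP.
by rewrite oner_eq0.
Qed.

(** From a point [x0] of the common face, go a little way towards the apex [c] of
    [L]: the point lies in [L], and in [K] because [c] is on the side of [K]. *)
Lemma same_side_meet K L F a c : is_simplex d K -> is_simplex d L ->
  (F `<=` K)%fset -> (F `<=` L)%fset -> #|` F| = d -> F != fset0 ->
  a \in K -> a \notin F -> c \in L -> c \notin F ->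
  0 < bcoord K a c -> exists x, open_hull K x /\ open_hull L x.
Proof.
move=> sK sL FK FL cF F0 aK aF cL cNF ac.
have [x0 x0F] := hull_center F0.
have KE := apexE sK.1 FK cF aK aF; have LE := apexE sL.1 FL cF cL cNF.
have [K1 K2] := (subhullP sK x0 FK).1 x0F.
have [L1 L2] := (subhullP sL x0 FL).1 x0F.
have nK : \forall t \near (0:R)^'+, forall i : 'I_(size (enum_fset F)),
    0 < bcoord K (nth 0 (enum_fset F) i) (x0 + t *: (c - x0)).
  apply: filter_forall => i; set v := nth _ _ _.
  have vF : v \in F by apply: mem_nth.
  under eq_near do rewrite bcoord_segment.
  have cphi : bcoord K v x0 + t * (bcoord K v c - bcoord K v x0) @[t --> (0:R)]
      --> bcoord K v x0.
    rewrite -[X in _ --> X]addr0; apply: cvgD; first exact: cvg_cst.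
    rewrite -[X in _ --> X](mul0r (bcoord K v c - bcoord K v x0)); apply: cvgMr_tmp.
    exact: cvg_id.
  apply: cvg_within; apply: (cvgr_gt _ cphi); exact: K1.
near (0:R)^'+ => t.
have t0 : 0 < t by near: t; exact: nbhs_right_gt.
have t1 : t < 1 by near: t; exact: nbhs_right_lt.
exists (x0 + t *: (c - x0)); split.
  apply/(open_hullP sK) => v; rewrite {1}KE !inE => /orP[/eqP->|vF].
    by rewrite bcoord_segment K2// add0r subr0 mulr_gt0.
  have vi : (index v (enum_fset F) < size (enum_fset F))%N by rewrite index_mem.
  suff : forall i : 'I_(size (enum_fset F)),
    0 < bcoord K (nth 0 (enum_fset F) i) (x0 + t *: (c - x0)).
    by move=> /(_ (Ordinal vi)); rewrite /= nth_index.
  by near: t.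
apply/(open_hullP sL) => v; rewrite {1}LE !inE => /orP[/eqP->|vF].
  by rewrite bcoord_segment (bcoord_vertex sL cL cL) eqxx L2// add0r subr0 mulr1.
have vL := fsubsetP FL _ vF.
rewrite bcoord_segment (bcoord_vertex sL cL vL) (_ : c == v = false); last first.
  by apply/negbTE; apply: contra cNF => /eqP ->.
by rewrite sub0r mulrN -[X in X - _]mul1r -mulrBl mulr_gt0 ?subr_gt0// L1.
Unshelve. all: by end_near. Qed.

End SameSide.

Section Adjacency.
Variables (R : realType) (d : nat) (Omega : set 'cV[R]_d).
Variables (M : {fset {fset 'cV[R]_d}}) (F : {fset 'cV[R]_d}).
Hypothesis d0 : (0 < d)%N.
Hypothesis rM : regular_partition Omega M.
Hypothesis fF : is_face M F.

Let cF : #|` F| = d. Proof. by have [K []] := fF. Qed.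
Let F0 : F != fset0. Proof. by rewrite -cardfs_gt0 cF. Qed.

(** Adjacency speaks of closures only. If [K] is not the element [K0] that has
    the face [F], the two closures meet in the closure of a common subsimplex
    [S]; a point of [F] has positive coordinates at all vertices of [F], so
    these belong to [S]. *)
Lemma adjacentP K : K \in adjacent_elements M F ->
  [/\ K \in M, is_simplex d K & (F `<=` K)%fset].
Proof.
rewrite !inE /= => /andP[KM /asboolP FcK].
have [sM _ _ cM] := rM; split => //; first exact: sM.
have [K0 [K0M FK0 _]] := fF.
have [->//|/eqP KK0] := eqVneq K K0.
have FcK0 := subhull_closure (sM _ K0M) FK0.
have [x0 x0F] := hull_center F0.
have [ne|[S [S0 SK SK0 cS]]] := cM _ _ KM K0M KK0.
  have : set0 x0 by rewrite -ne; split; [exact: FcK|exact: FcK0].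
  by [].
suff FS : (F `<=` S)%fset by exact: fsubset_trans SK.
apply/fsubsetP => v vF; apply/negPn/negP => vS.
have : closure (open_hull S) x0 by rewrite -cS; split; [exact: FcK|exact: FcK0].
move=> /(closure_subhull (sM _ K0M) SK0)/(_ v (fsubsetP FK0 _ vF))[_ /(_ vS)].
have [h _] := (subhullP (sM _ K0M) x0 FK0).1 x0F.
by move=> l0; have := h _ vF; rewrite l0 ltxx.
Qed.

Lemma adjacent_opposite K L a c : K \in adjacent_elements M F ->
  L \in adjacent_elements M F -> K != L ->
  a \in K -> a \notin F -> c \in L -> c \notin F -> bcoord K a c <= 0.
Proof.
move=> /adjacentP[KM sK FK] /adjacentP[LM sL FL] /eqP KL aK aF cL cNF.
rewrite leNgt; apply/negP => ac.
have [x [xK xL]] := same_side_meet sK sL FK FL cF F0 aK aF cL cNF ac.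
have [_ disj _ _] := rM.
by have : set0 x by rewrite -(disj _ _ KM LM KL).
Qed.

(** Two adjacent elements lie on opposite sides of the face, and there are only
    two sides: the coordinate of [a2] at [a0] is the product of the coordinate of
    [a2] at [a1] and that of [a1] at [a0]; both factors are nonpositive, so it
    cannot be negative. *)
Lemma num_adjacent_le2 : (num_adjacent M F <= 2)%N.
Proof.
rewrite leqNgt; apply/negP; rewrite /num_adjacent.
set A := adjacent_elements M F => cA.
pose K i : {fset 'cV[R]_d} := nth fset0 (enum_fset A) i.
have KA i : (i < 3)%N -> K i \in A.
  by move=> i3; apply: mem_nth; exact: leq_trans cA.
have Kn i j : (i < 3)%N -> (j < 3)%N -> i != j -> K i != K j.
  move=> i3 j3; rewrite nth_uniq ?fset_uniq//; exact: leq_trans cA.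
have ap i : (i < 3)%N -> exists a, a \in K i /\ a \notin F.
  move=> /KA/adjacentP[_ [cK _] FK].
  by have [a aK aF] := apex_exists cK FK cF; exists a.
have [a0 [a0K a0F]] := ap 0%N isT.
have [a1 [a1K a1F]] := ap 1%N isT.
have [a2 [a2K a2F]] := ap 2%N isT.
have [_ s0 F0K] := adjacentP (KA 0%N isT).
have [_ s1 F1K] := adjacentP (KA 1%N isT).
have [_ s2 F2K] := adjacentP (KA 2%N isT).
have l01 := adjacent_opposite (KA 0%N isT) (KA 1%N isT)
  (Kn 0%N 1%N isT isT isT) a0K a0F a1K a1F.
have l02 := adjacent_opposite (KA 0%N isT) (KA 2%N isT)
  (Kn 0%N 2%N isT isT isT) a0K a0F a2K a2F.
have l12 := adjacent_opposite (KA 1%N isT) (KA 2%N isT)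
  (Kn 1%N 2%N isT isT isT) a1K a1F a2K a2F.
have comb L c x : is_simplex d L -> (F `<=` L)%fset -> c \in L -> c \notin F ->
    bcoord (K 0%N) a0 x = bcoord L c x * bcoord (K 0%N) a0 c.
  move=> sL FL cL cNF; rewrite (bcoord_combination _ _ _ sL).
  rewrite {1}(apexE sL.1 FL cF cL cNF) big_fsetU1//= [X in _ + X]big1_seq ?addr0//.
  move=> u /andP[_ uF]; rewrite (bcoord_vertex s0 (fsubsetP F0K _ uF) a0K).
  by rewrite (_ : u == a0 = false) ?mulr0//; apply: contraNF a0F => /eqP <-.
(* The third apex would have to lie on the hyperplane of the face. *)
have l02_0 : bcoord (K 0%N) a0 a2 = 0.
  apply/eqP; rewrite eq_le l02 /= (comb (K 1%N) a1)//.
  exact: mulr_le0.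
have := comb (K 2%N) a2 a0 s2 F2K a2K a2F.
by rewrite l02_0 mulr0 (bcoord_vertex s0 a0K a0K) eqxx => /eqP; rewrite oner_eq0.
Qed.

Lemma opposite_vertex K a : K \in adjacent_elements M F ->
  (vertices M `&` closure (open_hull K)) `\` closure (open_hull F) = [set a] ->
  a \in K /\ a \notin F.
Proof.
move=> /adjacentP[KM sK FK] va; have [v vK vF] := apex_exists sK.1 FK cF.
suff <- : v = a by [].
have : [set a] v; last by [].
rewrite -va; split.
  by split; [exists K|exact: vertex_closure].
move=> /(closure_subhull sK FK)/(_ v vK)[_ /(_ vF)].
by rewrite bcoord_vertex// eqxx => /eqP; rewrite oner_eq0.
Qed.

End Adjacency.

Section Null.
Variables (R : realType) (d : nat).

(** The boundary of a simplex lies in finitely many hyperplanes. *)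
Lemma ae_bcoord_neq0 (K : {fset 'cV[R]_d}) : (0 < d)%N -> is_simplex d K ->
  ae_col (fun x => forall v, v \in K -> bcoord K v x != 0).
Proof.
move=> d0 sK.
have h (i : 'I_(size (enum_fset K))) :
    {ae @lebesgue_tuple R d, forall t,
      bcoord K (nth 0 (enum_fset K) i) (col_of_tuple t) != 0}.
  set v := nth _ _ _; have vK : v \in K by apply: mem_nth.
  have g0 := bgrad_neq0 d0 sK vK.
  exists (@col_of_tuple R d @^-1`
    [set x | (bgrad K v *m x) 0 0 + bary_bias K (vindex K v) 0 = 0]); split.
  - exact: (measurable_col_form _ _ (measurable_set1 0)).
  - exact: hyperplane_null.
  - by move=> t /= /negP/negPn/eqP; rewrite bcoordE.
have : {ae @lebesgue_tuple R d, forall t, forall i : 'I_(size (enum_fset K)),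
    bcoord K (nth 0 (enum_fset K) i) (col_of_tuple t) != 0}.
  exact: filter_forall.
apply: filterS => t ht v vK.
have vi : (index v (enum_fset K) < size (enum_fset K))%N by rewrite index_mem.
by have := ht (Ordinal vi); rewrite /= nth_index.
Qed.

End Null.

(** * Realizations of the network operations *)

Section Realization.
Variable R : realType.

Lemma depthE h d m (Phi : nn R h d m) : depth Phi = h.+1.
Proof.
elim: h d Phi => [//|h IH] d [k [[l r] Psi]] /=.
by rewrite IH.
Qed.

Lemma relu_subN (x : R) : relu x - relu (- x) = x.
Proof. by rewrite /relu oppr_max oppr0 opprK addr_max_min add0r. Qed.

Lemma realize_split_input h k m (Phi : nn R h k m) y z :
  realize (split_input Phi) (col_mx y z) = realize Phi (y - z).
Proof.
case: h Phi => [|h] /=.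
  by move=> l; rewrite /affine /= mul_row_col mulNmx mulmxBr.
move=> [j [[l r] Psi]] /=; congr realize; apply/matrixP => i c.
by rewrite mxE [RHS]mxE /affine /= mul_row_col mulNmx mulmxBr.
Qed.

Lemma realize_sconc h2 h1 d k m (Phi2 : nn R h2 d k) (Phi1 : nn R h1 k m) x :
  realize (nn_sconc Phi2 Phi1) x = realize Phi1 (realize Phi2 x).
Proof.
elim: h2 d Phi2 x => [|h2 IH] d /= Phi2 x; last first.
  by case: Phi2 => j [[l r] Psi] /=; exact: IH.
set u := affine Phi2 x.
have e : \col_i relu (affine (Layer (col_mx (weight Phi2) (- weight Phi2))
    (col_mx (bias Phi2) (- bias Phi2))) x i 0)
    = col_mx (map_mx (@relu R) u) (map_mx (@relu R) (- u)).
  rewrite -map_col_mx; apply/matrixP => i c; rewrite mxE [RHS]mxE ord1.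
  by rewrite /affine /= mul_col_mx add_col_mx mulNmx -opprD.
rewrite e realize_split_input; congr realize.
by apply/matrixP => i c; rewrite !mxE relu_subN.
Qed.

Lemma stack_col k1 k2 (r1 : 'I_k1 -> R -> R) (r2 : 'I_k2 -> R -> R)
    (u1 : 'cV[R]_k1) (u2 : 'cV[R]_k2) :
  \col_i stack r1 r2 i (col_mx u1 u2 i 0)
  = col_mx (\col_i r1 i (u1 i 0)) (\col_i r2 i (u2 i 0)).
Proof.
apply/matrixP => i c; rewrite !mxE /stack.
by case: (fintype.split i) => j; rewrite mxE.
Qed.

Lemma realize_par_diag h d1 d2 m1 m2 (P1 : nn R h d1 m1) (P2 : nn R h d2 m2)
    x1 x2 :
  realize (par_diag P1 P2) (col_mx x1 x2)
  = col_mx (realize P1 x1) (realize P2 x2).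
Proof.
elim: h d1 d2 P1 P2 x1 x2 => [|h IH] d1 d2 /=.
  move=> l1 l2 x1 x2; rewrite /affine /= mul_block_col !mul0mx addr0 add0r.
  by rewrite add_col_mx.
move=> [k1 [[l1 r1] P1]] [k2 [[l2 r2] P2]] x1 x2 /=; rewrite -IH -stack_col.
by rewrite /affine /= mul_block_col !mul0mx addr0 add0r add_col_mx.
Qed.

Lemma realize_par h d m1 m2 (P1 : nn R h d m1) (P2 : nn R h d m2) x :
  realize (nn_par P1 P2) x = col_mx (realize P1 x) (realize P2 x).
Proof.
case: h P1 P2 => [|h] /=.
  by move=> l1 l2; rewrite /affine /= mul_col_mx add_col_mx.
move=> [k1 [[l1 r1] P1]] [k2 [[l2 r2] P2]] /=.
by rewrite -realize_par_diag -stack_col /affine /= mul_col_mx add_col_mx.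
Qed.

Lemma realize_add_diag h d1 d2 m (P1 : nn R h d1 m) (P2 : nn R h d2 m) x1 x2 :
  realize (add_diag P1 P2) (col_mx x1 x2) = realize P1 x1 + realize P2 x2.
Proof.
elim: h d1 d2 P1 P2 x1 x2 => [|h IH] d1 d2 /=.
  by move=> l1 l2 x1 x2; rewrite /affine /= mul_row_col addrACA.
move=> [k1 [[l1 r1] P1]] [k2 [[l2 r2] P2]] x1 x2 /=; rewrite -IH -stack_col.
by rewrite /affine /= mul_block_col !mul0mx addr0 add0r add_col_mx.
Qed.

Lemma realize_add h d m (P1 P2 : nn R h d m) x :
  realize (nn_add P1 P2) x = realize P1 x + realize P2 x.
Proof.
case: h P1 P2 => [|h] /=.
  by move=> l1 l2; rewrite /affine /= mulmxDl addrACA.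
move=> [k1 [[l1 r1] P1]] [k2 [[l2 r2] P2]] /=.
by rewrite -realize_add_diag -stack_col /affine /= mul_col_mx add_col_mx.
Qed.

Lemma realize_zero h d m x : realize (nn_zero R h d m) x = 0.
Proof.
elim: h d x => [|h IH] d x /=; last exact: IH.
by rewrite /affine /= mul0mx addr0.
Qed.

Lemma realize_sum h d m (s : seq (nn R h d m)) x :
  realize (nn_sum s) x = \sum_(Phi <- s) realize Phi x.
Proof.
case: s => [|Phi s]; first by rewrite big_nil realize_zero.
rewrite big_cons /=; elim: s Phi => [|Psi s IH] Phi /=.
  by rewrite big_nil addr0.
by rewrite IH realize_add big_cons addrA.
Qed.

Lemma realize_times (kappa : R) (u v : 'cV[R]_1) :
  realize (times_nn 1 kappa) (col_mx u v) 0 0 =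
  kappa / 2 * (relu (u 0 0 / kappa + v 0 0) + relu (- (u 0 0 / kappa) - v 0 0)
    - relu (u 0 0 / kappa - v 0 0) - relu (- (u 0 0 / kappa) + v 0 0)).
Proof.
rewrite /times_nn /= /affine /= addr0.
rewrite (_ : \col_i relu _ = map_mx (@relu R) (col_mx
   (col_mx (kappa^-1 *: u + v) (- (kappa^-1) *: u - v))
   (col_mx (kappa^-1 *: u - v) (- (kappa^-1) *: u + v)))).
  rewrite !map_col_mx !mul_row_col !mul_scalar_mx !mxE.
  by rewrite !mulNr [kappa^-1 * _]mulrC; ring.
apply/matrixP => i j; rewrite mxE [RHS]mxE ord1; congr (relu (_ i 0)).
have c1 : const_mx 1 = 1%:M :> 'M[R]_1 by rewrite [LHS]mx11_scalar mxE.
by rewrite addr0 !mul_col_mx !mul_row_col c1 !mulNmx !mul_scalar_mx !scale1r.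
Qed.

Lemma realize_times0 (kappa : R) (u v : 'cV[R]_1) : v 0 0 = 0 ->
  realize (times_nn 1 kappa) (col_mx u v) 0 0 = 0.
Proof. by move=> v0; rewrite realize_times v0 !(addr0, subr0); ring. Qed.

Lemma realize_times1 (kappa : R) (u v : 'cV[R]_1) : 0 < kappa -> v 0 0 = 1 ->
  `|u 0 0| <= kappa -> realize (times_nn 1 kappa) (col_mx u v) 0 0 = u 0 0.
Proof.
move=> k0 v1 uk; rewrite realize_times v1; set w := u 0 0 / kappa.
have : `|w| <= 1 by rewrite normrM normfV (gtr0_norm k0) ler_pdivrMr// mul1r.
rewrite ler_norml => /andP[w1 w2].
have -> : relu (w + 1) = w + 1 by rewrite /relu max_r//; lra.
have -> : relu (- w - 1) = 0 by rewrite /relu max_l//; lra.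
have -> : relu (w - 1) = 0 by rewrite /relu max_l//; lra.
have -> : relu (- w + 1) = - w + 1 by rewrite /relu max_r//; lra.
by rewrite /w; field; rewrite gt_eqF.
Qed.

Lemma bisu_le1 (x : R) : bisu x <= 1. Proof. by rewrite /bisu; case: ifP. Qed.

Lemma realize_indicatorE d (K : {fset 'cV[R]_d}) x :
  realize (indicator_nn K) x 0 0
  = bisu (\sum_i bisu ((bary_weight K *m x + bary_bias K) i 0)
          - ((d + 1)%:R - 1 / 4)).
Proof.
rewrite /indicator_nn /= /affine /= mul1mx addr0 mxE; congr bisu.
rewrite [LHS]mxE [X in _ + X]mxE [X in X + _]mxE; congr (_ - _).
by apply: eq_bigr => i _; rewrite !mxE mul1r.
Qed.

Lemma realize_indicator1 d (K : {fset 'cV[R]_d}) x :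
  (forall i, 0 < (bary_weight K *m x + bary_bias K) i 0) ->
  realize (indicator_nn K) x 0 0 = 1.
Proof.
move=> h; rewrite realize_indicatorE (eq_bigr (fun=> 1)) => [|i _]; last first.
  by rewrite /bisu leNgt h.
rewrite sumr_const card_ord opprB addrCA subrr addr0 /bisu.
by rewrite leNgt divr_gt0.
Qed.

(** If one summand vanishes the sum is at most [d], below the threshold
    [d + 1 - 1 / 4]. *)
Lemma realize_indicator0 d (K : {fset 'cV[R]_d}) x i :
  (bary_weight K *m x + bary_bias K) i 0 <= 0 ->
  realize (indicator_nn K) x 0 0 = 0.
Proof.
move=> h; rewrite realize_indicatorE {1}/bisu ifT// (bigD1 i)//= {1}/bisu h add0r.
have : \sum_(j | j != i) bisu ((bary_weight K *m x + bary_bias K) j 0)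
    <= \sum_(j | j != i) (1 : R) by apply: ler_sum => j _; exact: bisu_le1.
rewrite sumr_const cardC1 card_ord [X in _ <= X](_ : _ = d%:R); last first.
  by rewrite addn1.
rewrite natrD => hs; lra.
Qed.

End Realization.

(** * Sizes of the network operations *)

Section Size.
Variable R : realType.

(** Counting the nonzero entries as a sum makes the block matrix formulas instances
    of the splitting of sums. *)
Lemma norm0E m n (A : 'M[R]_(m, n)) : norm0 A = (\sum_i \sum_j (A i j != 0%R))%N.
Proof.
rewrite /norm0 cardsE -sum1_card big_mkcond pair_big /=.
by apply: eq_bigr => p _; rewrite unfold_in; case: eqP.
Qed.

Lemma norm0_col_mx m1 m2 n (A : 'M[R]_(m1, n)) (B : 'M[R]_(m2, n)) :
  norm0 (col_mx A B) = (norm0 A + norm0 B)%N.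
Proof.
rewrite !norm0E big_split_ord /=; congr (_ + _)%N.
  by apply: eq_bigr => i _; apply: eq_bigr => j _; rewrite col_mxEu.
by apply: eq_bigr => i _; apply: eq_bigr => j _; rewrite col_mxEd.
Qed.

Lemma norm0_row_mx m n1 n2 (A : 'M[R]_(m, n1)) (B : 'M[R]_(m, n2)) :
  norm0 (row_mx A B) = (norm0 A + norm0 B)%N.
Proof.
rewrite !norm0E -big_split; apply: eq_bigr => i _; rewrite big_split_ord /=.
by congr (_ + _)%N; apply: eq_bigr => j _; rewrite (row_mxEl, row_mxEr).
Qed.

Lemma norm0_0 m n : norm0 (0 : 'M[R]_(m, n)) = 0%N.
Proof.
by rewrite norm0E big1// => i _; rewrite big1// => j _; rewrite mxE eqxx.
Qed.

Lemma norm0N m n (A : 'M[R]_(m, n)) : norm0 (- A) = norm0 A.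
Proof.
rewrite !norm0E; apply: eq_bigr => i _; apply: eq_bigr => j _.
by rewrite mxE oppr_eq0.
Qed.

Lemma norm0_le m n (A : 'M[R]_(m, n)) : (norm0 A <= m * n)%N.
Proof. by rewrite /norm0 (leq_trans (max_card _))// card_prod !card_ord. Qed.

Lemma norm0_add_le m n (A B : 'M[R]_(m, n)) :
  (norm0 (A + B) <= norm0 A + norm0 B)%N.
Proof.
rewrite !norm0E -big_split leq_sum// => i _; rewrite -big_split leq_sum// => j _ /=.
rewrite mxE; case: (eqVneq (A i j) 0) => [->|_]; first by rewrite add0r.
by case: (_ + _ != 0).
Qed.

Lemma norm0_block_diag m1 m2 n1 n2 (A : 'M[R]_(m1, n1)) (B : 'M[R]_(m2, n2)) :
  norm0 (block_mx A 0 0 B) = (norm0 A + norm0 B)%N.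
Proof. by rewrite /block_mx norm0_col_mx !norm0_row_mx !norm0_0 addn0. Qed.

Lemma size_split_input h k m (Phi : nn R h k m) :
  (nn_size (split_input Phi) <= 2 * nn_size Phi)%N.
Proof.
case: h Phi => [|h] /=.
  by move=> l; rewrite /layer_size /= norm0_row_mx norm0N; lia.
by move=> [j [[l r] Psi]] /=; rewrite /layer_size /= norm0_row_mx norm0N; lia.
Qed.

Lemma size_sconc h2 h1 d k m (Phi2 : nn R h2 d k) (Phi1 : nn R h1 k m) :
  (nn_size (nn_sconc Phi2 Phi1) <= 2 * nn_size Phi2 + 2 * nn_size Phi1)%N.
Proof.
elim: h2 d Phi2 => [|h2 IH] d /= Phi2.
  apply: leq_trans (leq_add (leqnn _) (size_split_input Phi1)) _.
  by rewrite /layer_size /= !norm0_col_mx !norm0N; lia.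
case: Phi2 => j [[l r] Psi] /=.
apply: leq_trans (leq_add (leqnn _) (IH _ Psi)) _.
by rewrite mulnDr -addnA leq_add// leq_pmull.
Qed.

Lemma size_par_diag h d1 d2 m1 m2 (P1 : nn R h d1 m1) (P2 : nn R h d2 m2) :
  nn_size (par_diag P1 P2) = (nn_size P1 + nn_size P2)%N.
Proof.
elim: h d1 d2 P1 P2 => [|h IH] d1 d2 /=.
  by move=> l1 l2; rewrite /layer_size /= norm0_block_diag norm0_col_mx; lia.
move=> [k1 [[l1 r1] P1]] [k2 [[l2 r2] P2]] /=; rewrite IH.
by rewrite /layer_size /= norm0_block_diag norm0_col_mx; lia.
Qed.

Lemma size_par h d m1 m2 (P1 : nn R h d m1) (P2 : nn R h d m2) :
  nn_size (nn_par P1 P2) = (nn_size P1 + nn_size P2)%N.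
Proof.
case: h P1 P2 => [|h] /=.
  by move=> l1 l2; rewrite /layer_size /= !norm0_col_mx; lia.
move=> [k1 [[l1 r1] P1]] [k2 [[l2 r2] P2]] /=; rewrite size_par_diag.
by rewrite /layer_size /= !norm0_col_mx; lia.
Qed.

Lemma size_add_diag h d1 d2 m (P1 : nn R h d1 m) (P2 : nn R h d2 m) :
  (nn_size (add_diag P1 P2) <= nn_size P1 + nn_size P2)%N.
Proof.
elim: h d1 d2 P1 P2 => [|h IH] d1 d2 /=.
  move=> l1 l2; rewrite /layer_size /= norm0_row_mx.
  by have := norm0_add_le (bias l1) (bias l2); lia.
move=> [k1 [[l1 r1] P1]] [k2 [[l2 r2] P2]] /=; have := IH _ _ P1 P2.
by rewrite /layer_size /= norm0_block_diag norm0_col_mx; lia.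
Qed.

Lemma size_add h d m (P1 P2 : nn R h d m) :
  (nn_size (nn_add P1 P2) <= nn_size P1 + nn_size P2)%N.
Proof.
case: h P1 P2 => [|h] /=.
  move=> l1 l2; rewrite /layer_size /=.
  have := norm0_add_le (bias l1) (bias l2).
  by have := norm0_add_le (weight l1) (weight l2); lia.
move=> [k1 [[l1 r1] P1]] [k2 [[l2 r2] P2]] /=; have := size_add_diag P1 P2.
by rewrite /layer_size /= !norm0_col_mx; lia.
Qed.

Lemma size_zero h d m : nn_size (nn_zero R h d m) = 0%N.
Proof. by elim: h d => [|h IH] d /=; rewrite /layer_size /= !norm0_0 ?IH. Qed.

Lemma size_sum h d m (s : seq (nn R h d m)) :
  (nn_size (nn_sum s) <= \sum_(Phi <- s) nn_size Phi)%N.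
Proof.
case: s => [|Phi s]; first by rewrite big_nil size_zero.
rewrite big_cons /=; elim: s Phi => [|Psi s IH] Phi /=.
  by rewrite big_nil addn0.
rewrite big_cons; apply: leq_trans (IH _) _.
by rewrite addnA leq_add2r size_add.
Qed.

Lemma size_times (kappa : R) : (nn_size (times_nn 1 kappa) <= 12)%N.
Proof.
rewrite /times_nn /= /layer_size /= !norm0_0 !addn0.
by apply: (@leq_trans (8 + 4)%N) => //; apply: leq_add; exact: norm0_le.
Qed.

Lemma size_indicator d (K : {fset 'cV[R]_d}) :
  (nn_size (indicator_nn K) <= (d + 1) * (d + 1) + (d + 1) + 2)%N.
Proof.
rewrite /indicator_nn /= /layer_size /= norm0_0 addn0.
apply: (@leq_trans
  ((d + 1) * d + (d + 1) * 1 + (1 * (d + 1) + 1 * 1 + 1 * 1))%N).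
  by do ![apply: leq_add]; exact: norm0_le.
by lia.
Qed.

(** The width of the hidden layer of [PhiId] is arbitrary, so the bound comes from
    its size and from sparsity of block matrices, not from layer dimensions. *)
Lemma size_CR0_nn d s (PhiId : nn R 1 1 1) (kappa : R)
    (T : 'I_s -> {fset 'cV[R]_d}) A b : (2 <= d)%N -> is_identity_nn PhiId ->
  (nn_size (CR0_nn PhiId kappa T A b) <= 30 * d ^ 2 * s)%N.
Proof.
move=> d2 [_ _ sId _]; rewrite /CR0_nn; apply: (leq_trans (size_sum _)).
rewrite big_map big_enum /= -[X in (_ <= _ * X)%N]card_ord mulnC -sum_nat_const.
apply: leq_sum => i _.
set Aff := nn_out (A i) (const_mx (b i)).
apply: (leq_trans (@size_sconc 2 1 _ _ _
  (nn_par (PhiId \odot Aff) (indicator_nn (T i))) (times_nn 1 kappa))).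
rewrite size_par.
have := size_times kappa; have := size_indicator (T i).
have : (nn_size Aff <= d + 1)%N.
  rewrite /Aff /nn_out /= /layer_size /=.
  have := norm0_le (A i); have := norm0_le (const_mx (b i) : 'cV[R]_1); lia.
have := size_sconc Aff PhiId.
have : (2 * d <= d * d)%N by rewrite leq_mul2r d2 orbT.
rewrite expnS expn1; move: sId.
move: (nn_size Aff) (nn_size PhiId) (nn_size (indicator_nn _)).
move: (nn_size (_ \odot _)) (nn_size (times_nn _ _)) => n1 n2 n3 n4 n5.
rewrite mulnDl !mulnDr; lia.
Qed.

End Size.

(** * The Crouzeix-Raviart network *)

Section Branch.
Variables (R : realType) (d : nat) (K : {fset 'cV[R]_d}) (a : 'cV[R]_d).
Hypothesis sK : is_simplex d K.
Hypothesis aK : a \in K.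

Lemma realize_indicator x :
  realize (indicator_nn K) x 0 0 = \1_(open_hull K) x.
Proof.
have cK := sK.1; rewrite indicE.
have bcoordK (i : 'I_(d + 1)) : (bary_weight K *m x + bary_bias K) i 0
    = bcoord K (nth 0 (enum_fset K) i) x by rewrite /bcoord vindex_nth.
have iK (i : 'I_(d + 1)) : nth 0 (enum_fset K) i \in K.
  by apply: mem_nth; rewrite cK -(addn1 d).
have [xK|xK] := pselect (open_hull K x).
  rewrite mem_set//; apply: realize_indicator1 => i.
  by rewrite bcoordK; apply: (open_hullP sK x).1.
rewrite memNset//; have : ~ forall v, v \in K -> 0 < bcoord K v x.
  by move/(open_hullP sK).
move=> /existsNP[v /not_implyP[vK /negP]]; rewrite -leNgt => lv.
apply: (realize_indicator0 (i := vindex K v)).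
by rewrite bcoordK nth_vindex.
Qed.

Lemma bcoord_le1 x : open_hull K x -> bcoord K a x <= 1.
Proof.
move=> /(open_hullP sK) xK; rewrite -(sum_bcoord sK x) (big_fsetD1 a)//= lerDl.
rewrite big_seq sumr_ge0// => v; rewrite !inE => /andP[_ vK].
by rewrite ltW ?xK.
Qed.

(** On the simplex the coordinate lies in ]0, 1], so the affine input lies in
    [1 - d, 1[ and hence within [kappa] as [d >= 2]; there the product network
    multiplies exactly by the indicator. *)
Lemma realize_branch (PhiId : nn R 1 1 1) (kappa : R) x :
  is_identity_nn PhiId -> (2 <= d)%N -> d%:R - 1 <= kappa ->
  realize (times_nn 1 kappa \odot
    nn_par (PhiId \odot nn_out (- d%:R *: bgrad K a)
              (const_mx (1 - d%:R * bary_bias K (vindex K a) 0)))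
           (indicator_nn K)) x 0 0
  = (1 - d%:R * bcoord K a x) * \1_(open_hull K) x.
Proof.
move=> [_ _ _ hId] d2 dk.
have d2R : 2 <= d%:R :> R by rewrite ler_nat.
have k0 : 0 < kappa by lra.
set Aff := nn_out _ _; set P := nn_par _ _.
have -> : realize (times_nn 1 kappa \odot P) x =
    realize (times_nn 1 kappa) (realize P x).
  exact: (@realize_sconc _ 2 1).
have -> : realize P x = col_mx (realize Aff x) (realize (indicator_nn K) x).
  rewrite /P (@realize_par _ 2); congr col_mx.
  by rewrite -[RHS]hId; exact: (@realize_sconc _ 0 1).
clear P; rewrite {}/Aff; set u := realize (nn_out _ _) x.
have uE : u 0 0 = 1 - d%:R * bcoord K a x.
  by rewrite /u /= /affine /= -scalemxAl bcoordE !mxE; ring.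
have := realize_indicator x; rewrite indicE.
have [xK|xK] := pselect (open_hull K x).
  rewrite mem_set// mulr1 => h; rewrite realize_times1// uE.
  have := bcoord_le1 xK; have := (open_hullP sK x).1 xK a aK.
  move: (bcoord K a x) => t t0 t1; rewrite ler_norml; apply/andP; split; nra.
by rewrite memNset// mulr0 => h; rewrite realize_times0.
Qed.

End Branch.

Section Shape.
Variables (R : realType) (m : nat).
Let d := m.+1.
Variables (K F : {fset 'cV[R]_d}) (a n : 'cV[R]_d).
Hypothesis sK : is_simplex d K.
Hypothesis FK : (F `<=` K)%fset.
Hypothesis cF : #|` F| = d.
Hypothesis aK : a \in K.
Hypothesis aF : a \notin F.

Lemma shape_formula x : unit_normal F n -> points_out_of K F n ->
  d%:R * (d%:R^-1 - (1 - kmeasure d.-1 (open_hull F) * dot (x - a) n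
    / (d%:R * kmeasure d (open_hull K)))) = 1 - d%:R * bcoord K a x.
Proof.
move=> un out; rewrite (height_formula sK FK cF aK aF un x out).
have d0 : d%:R != 0 :> R by rewrite pnatr_eq0.
by move: (d%:R) d0 => e e0; field.
Qed.

End Shape.

Lemma dotN (R : realType) d (u v : 'cV[R]_d) : dot u (- v) = - dot u v.
Proof. by rewrite /dot mulmxN mxE. Qed.

Lemma unit_normalN (R : realType) d (F : {fset 'cV[R]_d}) n :
  unit_normal F n -> unit_normal F (- n).
Proof.
move=> [nn h]; split; last by move=> x y xF yF; rewrite dotN h// oppr0.
by rewrite dotN /dot linearN /= mulNmx [X in - X]mxE opprK.
Qed.

Theorem proposition7p5 (R : realType) (PhiId : nn R 1 1 1)
    (hPhiId : is_identity_nn PhiId) :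
  exists C : R, 0 < C /\
  forall (d : nat) (Omega : set 'cV[R]_d) (M : {fset {fset 'cV[R]_d}})
    (F : {fset 'cV[R]_d}),
    (2 <= d)%N ->
    bounded_polytopal_domain Omega ->
    regular_partition Omega M ->
    is_face M F ->
    let s := num_adjacent M F in
    forall (T : 'I_s -> {fset 'cV[R]_d}) (a : 'I_s -> 'cV[R]_d),
    injective T ->
    (forall K, K \in adjacent_elements M F <-> exists i, K = T i) ->
    (forall i,
      (vertices M `&` closure (open_hull (T i))) `\` closure (open_hull F)
      = [set a i]) ->
    exists (A : 'I_s -> 'M[R]_(1, d)) (b : 'I_s -> R),
    forall kappa : R, d%:R - 1 <= kappa ->
    let Phi := CR0_nn PhiId kappa T A b in
    [/\ forall theta, is_CR0_shape Omega F T a theta ->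
          ae_col (fun x => Omega x -> theta x = realize Phi x 0 0),
        depth Phi = 5%N,
        (nn_size Phi)%:R <= C * d%:R ^+ 2 * s%:R &
        C * d%:R ^+ 2 * s%:R <= 2 * C * d%:R ^+ 2].
Proof.
exists 30; split; first by rewrite ltr0n.
move=> [//|m] Omega M F; set d := m.+1.
move=> d2 _ rM fF s T a injT adjT aT.
have d0 : (0 < d)%N by [].
have adj i : T i \in adjacent_elements M F by apply/adjT; exists i.
have TM i : T i \in M by have [] := adjacentP d0 rM fF (adj i).
have sT i : is_simplex d (T i) by have [] := adjacentP d0 rM fF (adj i).
have FT i : (F `<=` T i)%fset by have [] := adjacentP d0 rM fF (adj i).
have aTi i : a i \in T i by have [] := opposite_vertex d0 rM fF (adj i) (aT i).
have aFi i : a i \notin F by have [] := opposite_vertex d0 rM fF (adj i) (aT i).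
have cF : #|` F| = d by have [K []] := fF.
have s2 : (s <= 2)%N by exact: (num_adjacent_le2 d0 rM fF).
exists (fun i => - d%:R *: bgrad (T i) (a i)).
exists (fun i => 1 - d%:R * bary_bias (T i) (vindex (T i) (a i)) 0).
move=> kappa dk Phi; split.
- move=> theta thetaP.
  have Tdisj i j x : i != j -> open_hull (T i) x -> ~ open_hull (T j) x.
    move=> /eqP ij xi xj; have [_ disj _ _] := rM.
    have : set0 x by rewrite -(disj _ _ (TM i) (TM j))// => /injT.
    by [].
  (* The affine function that agrees with the shape function on T i. *)
  pose val i x := 1 - d%:R * bcoord (T i) (a i) x.
  have PhiE x : realize Phi x 0 0 = \sum_i val i x * \1_(open_hull (T i)) x.
    rewrite /Phi /CR0_nn realize_sum big_map big_enum /= summxE.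
    by apply: eq_bigr => i _; exact: realize_branch.
  have PhiIn i x : open_hull (T i) x -> realize Phi x 0 0 = val i x.
    move=> xi; rewrite PhiE (bigD1 i)//= indicE mem_set// mulr1.
    rewrite big1 ?addr0// => j ji.
    by rewrite indicE memNset ?mulr0//; apply: Tdisj xi; rewrite eq_sym.
  have PhiOut x : (forall i, ~ open_hull (T i) x) -> realize Phi x 0 0 = 0.
    by move=> h; rewrite PhiE big1// => i _; rewrite indicE memNset ?mulr0.
  have nb : {ae @lebesgue_tuple R d, forall t, forall i v, v \in T i ->
      bcoord (T i) v (col_of_tuple t) != 0}.
    by apply: filter_forall => i; exact: ae_bcoord_neq0.
  apply: filterS nb => t; set x := col_of_tuple t => nb _.
  case: thetaP => [[i1 [n [_ i1E un out ->]]]|[i1 [i2 [n []]]]].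
    rewrite (shape_formula (sT i1) (FT i1) cF (aTi i1) (aFi i1) x un out).
    rewrite PhiE (big_pred1 i1)// => i; apply/esym/eqP; exact: i1E.
  move=> _ [un [out1 out2]] h1 h2 h3.
  have [x1|x1] := pselect (open_hull (T i1) x).
    rewrite h1// (PhiIn i1)//.
    exact: (shape_formula (sT i1) (FT i1) cF (aTi i1) (aFi i1)).
  have [x2|x2] := pselect (open_hull (T i2) x).
    rewrite h2// (PhiIn i2)//.
    rewrite /val; have <- := shape_formula (sT i2) (FT i2) cF (aTi i2) (aFi i2) x
      (unit_normalN un) out2.
    by rewrite dotN mulrN mulNr opprK.
  have i12 : i1 != i2.
    apply/eqP => i12.
    have [y yT] : exists y, open_hull (T i1) y.
      by apply: hull_center; rewrite -cardfs_gt0 (sT i1).1.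
    have [z zF] : exists z, open_hull F z.
      by apply: hull_center; rewrite -cardfs_gt0 cF.
    have := out1 _ _ yT zF; rewrite i12 in yT; have := out2 _ _ yT zF.
    by rewrite dotN oppr_lt0 => /lt_trans h /h; rewrite ltxx.
  have all12 i : i = i1 \/ i = i2.
    have [->|ne1] := eqVneq i i1; first by left.
    have [->|ne2] := eqVneq i i2; first by right.
    have u3 : uniq [:: i; i1; i2] by rewrite /= !inE negb_or ne1 ne2 i12.
    have := max_card (mem [:: i; i1; i2]); rewrite (card_uniqP u3) card_ord.
    by move=> /leq_trans/(_ s2).
  (* Outside both open elements and off their boundaries both sides vanish. *)
  rewrite PhiOut; last by move=> i; case: (all12 i) => ->.
  apply: h3; rewrite closureU.
  move=> -[] /closure_subhull-/(_ _ (sT _) (fsubset_refl _)) cx.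
    apply: x1; apply/(open_hullP (sT i1)) => v vT.
    by rewrite lt_neqAle eq_sym nb// (cx v vT).1.
  apply: x2; apply/(open_hullP (sT i2)) => v vT.
  by rewrite lt_neqAle eq_sym nb// (cx v vT).1.
- exact: depthE.
- rewrite -natrX -!natrM ler_nat; exact: size_CR0_nn.
- rewrite -mulrA [2 * _]mulrC -[30 * 2 * _]mulrA ler_pM2l ?ltr0n//.
  by rewrite mulrC ler_wpM2r ?exprn_ge0// ler_nat.
Qed.
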